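(* Let $R$ be a commutative ring, and let $L$ be a connected $R$-homology $n$-manifold. Let $\Gamma$ be a group acting freely and simplicially on $L$. If $L$ is orientable, let $R^\circ$ stand for the right $R\Gamma$-module (with underlying $R$-module $R$) upon which an element $\gamma$ of $\Gamma$ acts as multiplication by $-1$ if it exchanges the two orientations of $L$ and as the identity if it preserves the orientations of $L$. If $R$ has characteristic two, let $R^\circ$ be $R$ with the trivial right $\Gamma$-action. Then if either $L$ is orientable or $R$ has characteristic two, there is for each $i$ an isomorphism of right $R\Gamma$-modules $$H_c^i(L;R)\otimes R^\circ\cong H_{n-i}(L;R).$$
   Context: Let $R$ be a (non-zero) commutative ring. An $R$-homology $n$-manifold is a locally finite simplicial complex $L$ such that the link of every $i$-simplex of $L$ has the same $R$-homology as an $(n-i-1)$-sphere, where a sphere of negative dimension is empty. (Then $L$ is $n$-dimensional and every $(n-1)$-simplex is a face of exactly two $n$-simplices.) $L$ is orientable if the $n$-simplices of $L$ may be oriented consistently across every $(n-1)$-simplex; such a choice of orientations of the $n$-simplices is an orientation of $L$. A connected $L$ has either two or zero orientations. For a locally finite simplicial complex $L$, the cohomology with compact supports $H_c^*(L;R)$ is the cohomology of the subcomplex of the $R$-valued simplicial cochains on $L$ consisting of the functions which vanish on all but finitely many simplices of $L$. The action of $\Gamma$ on $L$ induces a natural right action on $H_c^*(L;R)$ and a left action on $H_*(L;R)$, the latter regarded as a right action via $\gamma\mapsto\gamma^{-1}$. The tensor product is over $R$, with the diagonal $\Gamma$-action. *)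

(* Defs.v *)
From HB Require Import structures.
From mathcomp Require Import all_boot all_order all_algebra finmap.
From mathcomp Require Import boolp classical_sets functions cardinality fsbigop.

Set Implicit Arguments.
Unset Strict Implicit.
Unset Printing Implicit Defensive.

Import Order.TTheory GRing.Theory Num.Theory.

Local Open Scope ring_scope.
Local Open Scope classical_set_scope.

Record submodule (R : pzRingType) (W : lmodType R) := Submodule {
  smem :> W -> Prop;
  smem0 : smem 0;
  smemP : forall a x y, smem x -> smem y -> smem (a *: x + y) }.

Definition smpred (R : pzRingType) (W : lmodType R) (S : submodule W) :
  pred W := fun x => `[< S x >].

Section SubmodulePred.
Context {R : pzRingType} {W : lmodType R} (S : submodule W).

Lemma smpredP x : reflect (S x) (x \in smpred S).
Proof. exact: asboolP. Qed.

Lemma smpred_closed : submod_closed (smpred S).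
Proof.
split; first by apply/smpredP; exact: smem0.
by move=> a x y /smpredP Sx /smpredP Sy; apply/smpredP; exact: smemP.
Qed.

HB.instance Definition _ :=
  GRing.isSubmodClosed.Build R W (smpred S) smpred_closed.

End SubmodulePred.

Section Sub.
Context {R : pzRingType} {W : lmodType R} (S : submodule W).

Record sub_of := SubOf { sub_val : W; sub_valP : sub_val \in smpred S }.
HB.instance Definition _ := [isSub for sub_val].
HB.instance Definition _ := [Choice of sub_of by <:].
HB.instance Definition _ := [SubChoice_isSubLmodule of sub_of by <:].

End Sub.

Section Quot.
Context {R : pzRingType} {W : lmodType R} (S : submodule W).

Let pS : zmodClosed W := GRing.ZmodClosed.clone W (smpred S) _.

Definition quot_of : Type := Quotient.quot pS.
HB.instance Definition _ := GRing.Zmodule.on quot_of.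

Definition to_quot (x : W) : quot_of := (\pi_(Quotient.quot pS) x)%qT.
Definition of_quot (q : quot_of) : W := repr (q : Quotient.quot pS).

Lemma of_quotK : cancel of_quot to_quot.
Proof. exact: reprK. Qed.

Lemma to_quotP x y : to_quot x = to_quot y <-> S (x - y).
Proof.
rewrite /to_quot; split.
  by move=> /eqP; rewrite -Quotient.idealrBE => /smpredP.
by move=> h; apply/eqP; rewrite -Quotient.idealrBE; apply/smpredP.
Qed.

Lemma to_quotD : {morph to_quot : x y / x + y}.
Proof. by move=> x y; rewrite /to_quot raddfD. Qed.

Definition quot_scale (a : R) (q : quot_of) : quot_of :=
  to_quot (a *: of_quot q).

Lemma to_quotZ a x : quot_scale a (to_quot x) = to_quot (a *: x).
Proof.
rewrite /quot_scale; apply/to_quotP; rewrite -scalerBr -[_ *: _]addr0.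
by apply: smemP; [apply/to_quotP; rewrite of_quotK | exact: smem0].
Qed.

Fact quot_scaleA a b q : quot_scale a (quot_scale b q) = quot_scale (a * b) q.
Proof. by rewrite -[q]of_quotK !to_quotZ scalerA. Qed.
Fact quot_scale1 : left_id 1 quot_scale.
Proof. by move=> q; rewrite -[q]of_quotK to_quotZ scale1r. Qed.
Fact quot_scaleDr : right_distributive quot_scale +%R.
Proof.
move=> a p q; rewrite -[p]of_quotK -[q]of_quotK.
by rewrite -to_quotD !to_quotZ scalerDr to_quotD.
Qed.
Fact quot_scaleDl q : {morph quot_scale^~ q : a b / a + b}.
Proof. by move=> a b; rewrite -[q]of_quotK !to_quotZ scalerDl to_quotD. Qed.

HB.instance Definition _ := GRing.Zmodule_isLmodule.Build R quot_of
  quot_scaleA quot_scale1 quot_scaleDr quot_scaleDl.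

Lemma to_quot_linear : linear to_quot.
Proof. by move=> a x y; rewrite to_quotD -to_quotZ. Qed.

HB.instance Definition _ :=
  GRing.isLinear.Build R W quot_of *:%R to_quot to_quot_linear.

End Quot.

(* The quotient Z / (B \cap Z). *)
Section Subquotient.
Context {R : pzRingType} {W : lmodType R} (Z B : submodule W).

Definition restrict_sub : submodule (sub_of Z).
Proof.
exists (fun z : sub_of Z => B (val z)); first by rewrite raddf0; exact: smem0.
by move=> a x y Bx By; rewrite linearP; exact: smemP.
Defined.

Definition subquotient : lmodType R := quot_of restrict_sub.

Definition sq_class (z : sub_of Z) : subquotient := to_quot restrict_sub z.
Definition sq_repr (q : subquotient) : sub_of Z := of_quot (S := restrict_sub) q.

Lemma sq_reprK : cancel sq_repr sq_class.
Proof. exact: of_quotK. Qed.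

Lemma sq_classP x y : sq_class x = sq_class y <-> B (val x - val y).
Proof. by rewrite /sq_class to_quotP -(raddfB (val : sub_of Z -> W)). Qed.

Lemma sq_class_linear : linear sq_class.
Proof. exact: to_quot_linear. Qed.

End Subquotient.

Record right_action (R : pzRingType) (G : groupType) (M : lmodType R) :=
  RightAction {
    act_fun :> M -> G -> M;
    act_linear : forall g, linear (act_fun ^~ g);
    act1 : forall x, act_fun x 1%g = x;
    actM : forall x g h, act_fun x (g * h)%g = act_fun (act_fun x g) h }.

Record rmodule (R : pzRingType) (G : groupType) := RModule {
  rcar :> lmodType R;
  ract : right_action G rcar }.

Arguments ract {R G r} : rename.

Definition lmod_iso (R : pzRingType) (M N : lmodType R) : Prop :=
  exists f : {linear M -> N}, bijective f.

Definition rmodule_iso (R : pzRingType) (G : groupType)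
    (M N : rmodule R G) : Prop :=
  exists f : {linear M -> N},
    bijective f /\ forall x g, f (ract x g) = ract (f x) g.

Section SubquotientModule.
Context {R : pzRingType} {G : groupType} (M : rmodule R G).
Variables (Z B : submodule M).
Hypothesis Zact : forall x (g : G), Z x -> Z (ract x g).
Hypothesis Bact : forall x (g : G), B x -> B (ract x g).

Fact sub_act_subproof (z : sub_of Z) (g : G) : ract (val z) g \in smpred Z.
Proof. by apply/smpredP/Zact/smpredP; exact: valP. Qed.

Definition sub_act (z : sub_of Z) (g : G) : sub_of Z :=
  SubOf (sub_act_subproof z g).

Definition sq_act (q : subquotient Z B) (g : G) : subquotient Z B :=
  sq_class B (sub_act (sq_repr q) g).

Lemma sq_actE z g : sq_act (sq_class B z) g = sq_class B (sub_act z g).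
Proof.
apply/sq_classP => /=.
have rB : forall x y : M, ract (x - y) g = ract x g - ract y g.
  by move=> x y; rewrite addrC -scaleN1r act_linear scaleN1r addrC.
rewrite -rB; apply: Bact; apply/sq_classP; exact: sq_reprK.
Qed.

Fact sq_act_linear g : linear (sq_act ^~ g).
Proof.
move=> a p q; rewrite -[p]sq_reprK -[q]sq_reprK -sq_class_linear !sq_actE.
rewrite -sq_class_linear; congr sq_class; apply/val_inj => /=.
exact: act_linear.
Qed.

Fact sq_act1 q : sq_act q 1%g = q.
Proof.
rewrite -[q]sq_reprK sq_actE; congr sq_class; apply/val_inj => /=.
exact: act1.
Qed.

Fact sq_actM q g h : sq_act q (g * h)%g = sq_act (sq_act q g) h.
Proof.
rewrite -[q]sq_reprK !sq_actE; congr sq_class; apply/val_inj => /=.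
exact: actM.
Qed.

Definition subquotient_rmodule : rmodule R G :=
  RModule (RightAction sq_act_linear sq_act1 sq_actM).

End SubquotientModule.

Definition fin_supported (T : Type) (A : zmodType) (f : T -> A) : Prop :=
  finite_set [set x | f x != 0].

Lemma fin_supportedP (R : pzRingType) (M : lmodType R) (T : choiceType) (a : R)
    (f g : T -> M) : fin_supported f -> fin_supported g -> fin_supported (a *: f + g).
Proof.
move=> ff fg; have : finite_set ([set x | f x != 0] `|` [set x | g x != 0]).
  by rewrite finite_setU.
apply: sub_finite_set => x /=; rewrite !fctE; case: (eqVneq (f x) 0) => [->|_].
  by rewrite scaler0 add0r; right.
by left.
Qed.

Lemma fin_supported0 (T : Type) (A : zmodType) : fin_supported (0 : T -> A).
Proof.
by rewrite /fin_supported (_ : [set x | _] = set0) // -subset0 => x /=; rewrite eqxx.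
Qed.

Section Tensor.
Context {R : comNzRingType}.

(* The free R-module on M * N is realised as the finitely supported functions,
   [pure_delta m n] being the basis element indexed by (m, n). *)
Definition pure_delta (M N : lmodType R) (m : M) (n : N) : M * N -> R^o :=
  fun p => (p == (m, n))%:R.

Definition tensor_rel (M N : lmodType R) : set (M * N -> R^o) :=
  [set r | exists (a : R) (m m' : M) (n : N),
      r = pure_delta (a *: m + m') n - (a *: pure_delta m n + pure_delta m' n)]
  `|`
  [set r | exists (a : R) (m : M) (n n' : N),
      r = pure_delta m (a *: n + n') - (a *: pure_delta m n + pure_delta m n')].

Definition tensor_free (M N : lmodType R) : submodule (M * N -> R^o).
Proof.
exists (@fin_supported _ R^o); first exact: fin_supported0.
by move=> a x y; exact: fin_supportedP.
Defined.

Definition tensor_span (M N : lmodType R) : submodule (M * N -> R^o).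
Proof.
exists (fun f => forall S : submodule (M * N -> R^o),
          @tensor_rel M N `<=` smem S -> S f).
  by move=> S _; exact: smem0.
by move=> a x y Bx By S rS; apply: smemP; [exact: Bx|exact: By].
Defined.

Context {G : groupType} (M N : rmodule R G).

(* (f g)(m, n) = f(m g^-1, n g^-1), so that the basis element (m, n) is sent
   to (m g, n g). *)
Definition diag_act (f : M * N -> R^o) (g : G) : M * N -> R^o :=
  fun p => f (ract p.1 g^-1%g, ract p.2 g^-1%g).

Fact diag_act_linear g : linear (diag_act ^~ g).
Proof. by []. Qed.
Fact diag_act1 f : diag_act f 1%g = f.
Proof. by apply/funext => -[m n]; rewrite /diag_act /= invg1 !act1. Qed.
Fact diag_actM f g h : diag_act f (g * h)%g = diag_act (diag_act f g) h.
Proof. by apply/funext => -[m n]; rewrite /diag_act /= invgM !actM. Qed.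

Definition free_rmodule : rmodule R G :=
  RModule (RightAction diag_act_linear diag_act1 diag_actM).

Lemma ractK (P : rmodule R G) (g : G) :
  cancel (ract (r := P) ^~ g) (ract (r := P) ^~ g^-1%g).
Proof. by move=> x; rewrite -actM mulgV act1. Qed.
Lemma ractVK (P : rmodule R G) (g : G) :
  cancel (ract (r := P) ^~ g^-1%g) (ract (r := P) ^~ g).
Proof. by move=> x; rewrite -actM mulVg act1. Qed.

Lemma diag_act_delta (m : M) (n : N) g :
  diag_act (pure_delta m n) g = pure_delta (ract m g) (ract n g).
Proof.
apply/funext => -[m' n']; rewrite /diag_act /pure_delta /= !xpair_eqE.
by rewrite (can2_eq (ractVK _) (ractK _)) (can2_eq (ractVK _) (ractK _)).
Qed.

Lemma tensor_free_act (f : free_rmodule) (g : G) :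
  tensor_free M N f -> tensor_free M N (ract f g).
Proof.
move=> ff; apply: (@sub_finite_set _ _
  ((fun p : M * N => (ract p.1 g, ract p.2 g)) @` [set p | f p != 0])).
  move=> [m n] /= fp; exists (ract m g^-1%g, ract n g^-1%g) => //=.
  by rewrite !ractVK.
exact: finite_image.
Qed.

Lemma tensor_span_act (f : free_rmodule) (g : G) :
  tensor_span M N f -> tensor_span M N (ract f g).
Proof.
move=> Bf S rS.
have S0 : smem S (diag_act 0 g) by exact: smem0.
have SP a x y : S (diag_act x g) -> S (diag_act y g) ->
  S (diag_act (a *: x + y) g) by exact: smemP.
apply: (Bf (@Submodule _ _ (fun f => S (diag_act f g)) S0 SP)) => r /= rr.
apply: rS; case: rr => [[a [m [m' [n ->]]]]|[a [m [n [n' ->]]]]].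
  left; exists a, (ract m g), (ract m' g), (ract n g).
  by rewrite -act_linear -!diag_act_delta.
right; exists a, (ract m g), (ract n g), (ract n' g).
by rewrite -act_linear -!diag_act_delta.
Qed.

Definition tensor : rmodule R G :=
  subquotient_rmodule (M := free_rmodule) tensor_free_act tensor_span_act.

End Tensor.

Record complex (V : choiceType) := Complex {
  simplex :> {fset V} -> Prop;
  simplex_nonempty : ~ simplex fset0;
  simplex_face : forall s t : {fset V},
    simplex t -> (s `<=` t)%fset -> s != fset0 -> simplex s }.

Definition dim (V : choiceType) (s : {fset V}) : int := (#|` s|)%:Z - 1.

Definition locally_finite (V : choiceType) (L : complex V) : Prop :=
  forall v : V, finite_set [set s | L s /\ v \in s].

Definition connected_complex (V : choiceType) (L : complex V) : Prop :=
  (exists v, L [fset v]%fset) /\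
  forall u v, L [fset u]%fset -> L [fset v]%fset ->
    exists p : seq V, path (fun x y => `[< L [fset x; y]%fset >]) u p
                      /\ last u p = v.

Definition link (V : choiceType) (L : complex V) (s : {fset V}) : complex V.
Proof.
exists (fun t => [/\ t != fset0, [disjoint t & s]%fset & L (t `|` s)%fset]).
  by case; rewrite eqxx.
move=> t' t [t0 ts Lts] t't t'0; split=> //; first exact: fdisjointWl ts.
apply: simplex_face Lts _ _; first exact: fsetSU.
by rewrite fsetU_eq0 negb_and t'0.
Defined.

(* The m-sphere, as the boundary of the (m+1)-simplex on m+2 vertices; it is
   empty for m < 0. *)
Definition sphere_verts (m : int) : nat := if m is Posz k then k.+2 else 0%N.

Definition sphere (m : int) : complex 'I_(sphere_verts m).
Proof.
exists (fun s => s != fset0 /\ exists x, x \notin s).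
  by case; rewrite eqxx.
move=> s t [_ [x xt]] st s0; split=> //; exists x.
by apply: contra xt; apply/fsubsetP.
Defined.

(* A k-simplex together with an ordering of its vertices is a duplicate-free
   sequence of length k+1. Both oriented chains and cochains are functions on
   such sequences that change sign when two neighbouring vertices, hence any two
   vertices, are exchanged, extended by 0 to all sequences. A k-chain is
   identified with its (finitely supported) function of coefficients: the
   elementary chain [v_0, ..., v_k] takes the value sgn(p) at
   (v_p(0), ..., v_p(k)) and 0 at all other sequences. *)

Section Chains.
Context {V : choiceType}.
Implicit Types (L : complex V) (k : int) (s : seq V).

Definition ordered_simplex L s : Prop := uniq s /\ L [fset x in s]%fset.

Definition alternating L k (A : zmodType) (f : seq V -> A) : Prop :=
  (forall s, ~ (ordered_simplex L s /\ (size s)%:Z - 1 = k) -> f s = 0) /\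
  (forall s x y t, f (s ++ x :: y :: t) = - f (s ++ y :: x :: t)).

Section Coefficients.
Variable R : comNzRingType.
Implicit Types f : seq V -> R^o.

Definition chain L k f : Prop := alternating L k f /\ fin_supported f.

(* The coefficient of d[v_0, ..., v_k] = sum_i (-1)^i [v_0, ..,^v_i,.., v_k]
   at (v_0, ..,^v_i,.., v_k) is (-1)^i, which is the value of [v_0, ..., v_k] at
   (v_i, v_0, ..,^v_i,.., v_k). There are no simplices of dimension -1. *)
Definition boundary f : seq V -> R^o := fun s =>
  if s is [::] then 0 else \sum_(x \in [set: V]) f (x :: s).

Definition coboundary L f : seq V -> R^o := fun s =>
  if `[< ordered_simplex L s >]
  then \sum_(i < size s) (-1) ^+ i * f (take i s ++ drop i.+1 s) else 0.

Definition compact_cochain L k f : Prop := alternating L k f /\ fin_supported f.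

Lemma alternatingP L k (a : R) f g :
  alternating L k f -> alternating L k g -> alternating L k (a *: f + g).
Proof.
move=> [f0 fN] [g0 gN]; split=> [s Ls|s x y t]; rewrite !fctE.
  by rewrite f0 // g0 // scaler0 addr0.
by rewrite fN gN scalerN opprD.
Qed.

Lemma alternating0 L k : alternating L k (0 : seq V -> R^o).
Proof. by split=> [//|s x y t]; apply: esym; exact: (@oppr0 R^o). Qed.

Lemma boundary_linear (a : R) f g : fin_supported f -> fin_supported g ->
  boundary (a *: f + g) = a *: boundary f + boundary g.
Proof.
move=> ff fg; apply/funext => -[|y s]; first by rewrite !fctE scaler0 addr0.
rewrite /boundary !fctE /=.
pose A := fset_set ([set x | f (x :: y :: s) != 0] `|`
                    [set x | g (x :: y :: s) != 0]).
have fin (h : seq V -> R^o) :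
    fin_supported h -> finite_set [set x | h (x :: y :: s) != 0].
  move=> fh; apply: (@sub_finite_set _ _ ((head y) @` [set t | h t != 0])).
    by move=> x hx; exists (x :: y :: s).
  exact: finite_image.
have nA x : x \notin A -> f (x :: y :: s) = 0 /\ g (x :: y :: s) = 0.
  rewrite in_fset_set ?finite_setU; last by split; exact: fin.
  move/negP => nA; split; apply/eqP/negPn/negP => h; apply: nA; rewrite inE.
    by left.
  by right.
rewrite !(@fsbigTE _ _ _ _ A); last 3 first.
- by move=> x /nA[].
- by move=> x /nA[].
- by move=> x /nA[-> ->]; rewrite scaler0 addr0.
by rewrite scaler_sumr -big_split.
Qed.

Lemma coboundary_linear L (a : R) f g :
  coboundary L (a *: f + g) = a *: coboundary L f + coboundary L g.
Proof.
apply/funext => s; rewrite /coboundary !fctE.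
case: asboolP => _; last by rewrite scaler0 addr0.
rewrite scaler_sumr -big_split; apply: eq_bigr => i _ /=.
by rewrite mulrDr -[_ *: (_ * _)]/(_ * (_ * _)) mulrCA.
Qed.

Definition cycles L k : submodule (seq V -> R^o).
Proof.
exists (fun f => chain L k f /\ boundary f = 0).
  split; first by split; [exact: alternating0 | exact: fin_supported0].
  apply/funext => -[|x s] //; rewrite /boundary.
  by rewrite fsbig1.
move=> a f g [[af ff] bf] [[ag fg] bg]; split.
  by split; [exact: alternatingP | exact: fin_supportedP].
by rewrite boundary_linear // bf bg scaler0 addr0.
Defined.

Definition boundaries L k : submodule (seq V -> R^o).
Proof.
exists (fun f => exists2 c, chain L (k + 1) c & f = boundary c).
  exists 0; first by split; [exact: alternating0 | exact: fin_supported0].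
  by apply/funext => -[|x s] //; rewrite /boundary fsbig1.
move=> a f g [c [ac fc] ->] [d [ad fd] ->]; exists (a *: c + d).
  by split; [exact: alternatingP | exact: fin_supportedP].
by rewrite boundary_linear.
Defined.

Definition compact_cocycles L k : submodule (seq V -> R^o).
Proof.
exists (fun f => compact_cochain L k f /\ coboundary L f = 0).
  split; first by split; [exact: alternating0 | exact: fin_supported0].
  apply/funext => s; rewrite /coboundary; case: asboolP => // _.
  by rewrite big1 // => i _; rewrite mulr0.
move=> a f g [[af ff] bf] [[ag fg] bg]; split.
  by split; [exact: alternatingP | exact: fin_supportedP].
by rewrite coboundary_linear // bf bg scaler0 addr0.
Defined.

Definition compact_coboundaries L k : submodule (seq V -> R^o).
Proof.
exists (fun f => exists2 c, compact_cochain L (k - 1) c & f = coboundary L c).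
  exists 0; first by split; [exact: alternating0 | exact: fin_supported0].
  apply/funext => s; rewrite /coboundary; case: asboolP => // _.
  by rewrite big1 // => i _; rewrite mulr0.
move=> a f g [c [ac fc] ->] [d [ad fd] ->]; exists (a *: c + d).
  by split; [exact: alternatingP | exact: fin_supportedP].
by rewrite coboundary_linear.
Defined.

End Coefficients.
End Chains.

Definition homology (R : comNzRingType) (V : choiceType) (L : complex V)
    (k : int) : lmodType R :=
  subquotient (cycles R L k) (boundaries R L k).

Definition compact_cohomology (R : comNzRingType) (V : choiceType)
    (L : complex V) (k : int) : lmodType R :=
  subquotient (compact_cocycles R L k) (compact_coboundaries R L k).

Definition homology_manifold (R : comNzRingType) (n : nat) (V : choiceType)
    (L : complex V) : Prop :=
  locally_finite L /\
  forall s, L s -> forall k : int,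
    lmod_iso (homology R (link L s) k)
             (homology R (sphere (n%:Z - dim s - 1)) k).

(* An orientation of the n-simplices is encoded by the alternating function o
   with o s = 1 if the ordering s is positive, and o s = -1 if it is negative.
   A 0-simplex has two orientations as well, given by the sign. Consistency
   says that two n-simplices induce opposite orientations on a common face. *)
Definition orientation (n : nat) (V : choiceType) (L : complex V)
    (o : seq V -> int) : Prop :=
  [/\ alternating L n%:Z o,
      forall s, ordered_simplex L s -> size s = n.+1 -> o s = 1 \/ o s = -1 &
      forall t x y, ordered_simplex L t -> size t = n -> x != y ->
        ordered_simplex L (x :: t) -> ordered_simplex L (y :: t) ->
        o (x :: t) = - o (y :: t)].

Definition orientable (n : nat) (V : choiceType) (L : complex V) : Prop :=
  exists o, orientation n L o.

(* The action is given on all of V; the elements of V which are not vertices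
   of L play no role. *)
Record simplicial_action (G : groupType) (V : choiceType) (L : complex V) :=
  SimplicialAction {
    sact :> G -> V -> V;
    sact1 : forall v, sact 1%g v = v;
    sactM : forall g h v, sact (g * h)%g v = sact g (sact h v);
    sact_simplex : forall g s, L s -> L [fset sact g x | x in s]%fset }.

(* No nontrivial element maps a simplex to itself, i.e. the action on the
   geometric realisation has no fixed point. *)
Definition free_action (G : groupType) (V : choiceType) (L : complex V)
    (a : simplicial_action G L) : Prop :=
  forall g s, L s -> [fset a g x | x in s]%fset = s -> g = 1%g.

Section Actions.
Context {G : groupType} {V : choiceType} {L : complex V}.
Variable a : simplicial_action G L.

(* The left action on functions of ordered simplices: it sends the elementary
   chain [v_0, ..., v_k] to [g v_0, ..., g v_k], and an orientation o to the
   one in which g s is positive when s is positive in o. *)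
Definition push (A : Type) (g : G) (f : seq V -> A) : seq V -> A :=
  fun s => f (map (a g^-1%g) s).

Definition pull (A : Type) (f : seq V -> A) (g : G) : seq V -> A :=
  fun s => f (map (a g) s).

Definition exchanges_orientations (n : nat) (g : G) : Prop :=
  forall o, orientation n L o -> push g o = - o.

Definition preserves_orientations (n : nat) (g : G) : Prop :=
  forall o, orientation n L o -> push g o = o.

Lemma pull1 A (f : seq V -> A) : pull f 1%g = f.
Proof.
apply/funext => s; rewrite /pull; congr f; rewrite -[RHS]map_id.
by apply: eq_map => v; exact: sact1.
Qed.

Lemma pullM A (f : seq V -> A) g h : pull f (g * h)%g = pull (pull f g) h.
Proof.
apply/funext => s; rewrite /pull -map_comp; congr f.
by apply: eq_map => v; exact: sactM.
Qed.

Lemma push_pull A (f : seq V -> A) g : push g^-1%g f = pull f g.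
Proof. by rewrite /push invgK. Qed.

Lemma sactK g : cancel (a g) (a g^-1%g).
Proof. by move=> v; rewrite -sactM mulVg sact1. Qed.
Lemma sactVK g : cancel (a g^-1%g) (a g).
Proof. by move=> v; rewrite -sactM mulgV sact1. Qed.

Lemma ordered_simplex_map g s :
  ordered_simplex L (map (a g) s) <-> ordered_simplex L s.
Proof.
have E h t : ([fset x in map (a h) t] = [fset a h x | x in [fset y in t]])%fset.
  apply/fsetP => x; rewrite !inE; apply/mapP/imfsetP => /=.
    by case=> y yt ->; exists y; rewrite ?inE.
  by case=> y; rewrite inE => yt ->; exists y.
split=> -[us Ls]; split.
- by rewrite (map_inj_uniq (can_inj (sactK g))) in us.
- have := sact_simplex a g^-1%g Ls; rewrite -E -map_comp.
  by rewrite (eq_map (g := id)) ?map_id // => v; exact: sactK.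
- by rewrite (map_inj_uniq (can_inj (sactK g))).
- by rewrite E; exact: sact_simplex.
Qed.

Section Modules.
Variable R : comNzRingType.
Implicit Types f : seq V -> R^o.

Lemma pull_alternating k f g : alternating L k f -> alternating L k (pull f g).
Proof.
move=> [f0 fN]; split=> [s Ls|s x y t].
  by apply: f0; rewrite size_map => -[/ordered_simplex_map]; move=> *; apply: Ls.
by rewrite /pull !map_cat /= fN.
Qed.

Lemma pull_fin_supported f g : fin_supported f -> fin_supported (pull f g).
Proof.
move=> ff; apply: (@sub_finite_set _ _
  ((map (a g^-1%g)) @` [set s | f s != 0])); last exact: finite_image.
move=> s /= fs; exists (map (a g) s) => //; rewrite -map_comp.
by rewrite (eq_map (g := id)) ?map_id // => v; exact: sactK.
Qed.

Lemma pull_boundary f g : pull (boundary f) g = boundary (pull f g).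
Proof.
apply/funext => -[|y s] //; rewrite /pull /boundary /=.
apply: (reindex_fsbigT (a g) (fun x => f (x :: map (a g) (y :: s)))).
by exists (a g^-1%g); [exact: sactK | exact: sactVK].
Qed.

Lemma pull_coboundary f g : pull (coboundary L f) g = coboundary L (pull f g).
Proof.
apply/funext => s; rewrite /pull /coboundary /=.
have -> : `[< ordered_simplex L [seq a g i | i <- s] >] =
          `[< ordered_simplex L s >].
  by apply/asbool_equiv_eq; exact: ordered_simplex_map.
case: asboolP => // _; rewrite size_map; apply: eq_bigr => i _.
by rewrite map_cat map_take map_drop.
Qed.

Lemma pull0 g : pull (0 : seq V -> R^o) g = 0.
Proof. by []. Qed.

(* The left action c |-> push g c on chains, regarded as a right action. *)
Definition chain_act (c : seq V -> R^o) (g : G) : seq V -> R^o :=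
  push g^-1%g c.

Fact chain_act_linear g : linear (chain_act ^~ g).
Proof. by []. Qed.
Fact chain_act1 c : chain_act c 1%g = c.
Proof. by rewrite /chain_act push_pull pull1. Qed.
Fact chain_actM c g h : chain_act c (g * h)%g = chain_act (chain_act c g) h.
Proof. by rewrite /chain_act !push_pull pullM. Qed.

Definition chain_rmodule : rmodule R G :=
  RModule (RightAction chain_act_linear chain_act1 chain_actM).

Fact pull_linear g : linear (fun f => pull f g).
Proof. by []. Qed.

Definition cochain_rmodule : rmodule R G :=
  RModule (RightAction pull_linear (@pull1 _) (@pullM _)).

Fact cycles_act k (c : chain_rmodule) (g : G) :
  cycles R L k c -> cycles R L k (ract c g).
Proof.
rewrite /= /chain_act push_pull => -[[ac fc] bc]; split.
  by split; [exact: pull_alternating | exact: pull_fin_supported].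
by rewrite -pull_boundary bc pull0.
Qed.

Fact boundaries_act k (c : chain_rmodule) (g : G) :
  boundaries R L k c -> boundaries R L k (ract c g).
Proof.
rewrite /= /chain_act push_pull => -[d [ad fd] ->]; exists (pull d g).
  by split; [exact: pull_alternating | exact: pull_fin_supported].
exact: pull_boundary.
Qed.

Definition homology_rmodule (k : int) : rmodule R G :=
  subquotient_rmodule (@cycles_act k) (@boundaries_act k).

Fact compact_cocycles_act k (f : cochain_rmodule) (g : G) :
  compact_cocycles R L k f -> compact_cocycles R L k (ract f g).
Proof.
move=> /= -[[af ff] bf]; split.
  by split; [exact: pull_alternating | exact: pull_fin_supported].
by rewrite -pull_coboundary bf pull0.
Qed.

Fact compact_coboundaries_act k (f : cochain_rmodule) (g : G) :
  compact_coboundaries R L k f -> compact_coboundaries R L k (ract f g).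
Proof.
move=> /= -[d [ad fd] ->]; exists (pull d g).
  by split; [exact: pull_alternating | exact: pull_fin_supported].
exact: pull_coboundary.
Qed.

Definition compact_cohomology_rmodule (k : int) : rmodule R G :=
  subquotient_rmodule (@compact_cocycles_act k) (@compact_coboundaries_act k).

End Modules.
End Actions.

(* The right R G-module structure on R by orientation signs. The first clause
   determines it when L is orientable, since each element of G then exchanges or
   preserves the two orientations of a connected homology manifold. *)
Definition orientation_action (R : comNzRingType) (n : nat) (G : groupType)
    (V : choiceType) (L : complex V) (a : simplicial_action G L)
    (t : right_action G R^o) : Prop :=
  (orientable n L -> forall (g : G) (x : R^o),
     (exchanges_orientations a n g -> t x g = - x) /\
     (preserves_orientations a n g -> t x g = x)) /\
  (2%N \in [pchar R] -> forall (g : G) (x : R^o), t x g = x).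

(* Main.v *)
From HB Require Import structures.
Require Import Defs.
From mathcomp Require Import all_boot all_order all_algebra finmap.
From mathcomp Require Import boolp classical_sets functions cardinality fsbigop.
From mathcomp Require Import zify ring.

Set Implicit Arguments.
Unset Strict Implicit.
Unset Printing Implicit Defensive.

Import Order.TTheory GRing.Theory Num.Theory.
Local Open Scope ring_scope.

(** Poincare duality is proved with the double complex of the functions
    [F(s, t)] of pairs of incident simplices [s], [t] of [L], the vertices of [s]
    being vertices of [t], that are alternating in both variables and finitely
    supported, with the coboundary in [s] and the boundary in [t]. It contains
    both complexes to be compared, and each inclusion is a quasi-isomorphism
    because the double complex is acyclic in the other direction.

    For a fixed [t], the simplices [s] are the faces of [t], and a simplex has the
    cohomology of a point. A chain [c] of [L] embeds as the function with value
    [c(t)] at [(v, t)] for every vertex [v] of [t]; up to a total boundary, every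
    total cycle comes from such a chain ([reduce_to_chain]).

    For a fixed [s], the simplices [t] form the star of [s], whose chain complex
    is the augmented chain complex of the link of [s] up to a shift. The link has
    the homology of a sphere, so the homology of the star is concentrated in
    degree [n] ([star_exact]), and there it is generated by an orientation [mu]
    with values in [R] ([star_top]). A compactly supported cochain [f] embeds as
    [f(s) mu(t)], and up to a total boundary every total cycle comes from such a
    cochain ([reduce_to_cochain]).

    A compactly supported cocycle [f] and a cycle [c] correspond when their images
    differ by a total boundary ([dual]); this is an isomorphism on cohomology and
    homology ([duality]), for [f(s) mu(t)] has degree [n - i] when [f] has degree
    [i]. The complexes and the two embeddings are canonical, save for [mu]: a
    group element multiplies [mu] by the sign by which it acts on the twisted
    module ([orientation_action_char]). Hence the isomorphism is equivariant up to
    this sign ([dual_pull]), and tensoring absorbs the sign ([tensor_twist]). The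
    choices of vertices and of preimages in the exactness proofs break the
    symmetry, but they only show that some total boundary exists.

    The homology of the links is given up to unspecified isomorphisms. What is
    read off from them are numbers of generators: 0 for a vanishing homology, 1
    for a cyclic one, and 2 for the link of an [n - 1]-simplex, which is thereby
    seen to consist of two points. *)

(** * Alternating functions on sequences *)

Lemma swap_perm (T : eqType) (s t : seq T) x y :
  perm_eq (s ++ x :: y :: t) (s ++ y :: x :: t).
Proof. by rewrite perm_cat2l (perm_catCA [:: x] [:: y]). Qed.

(** Sign rules are given for exchanges of neighbours; this is how they reach
    arbitrary rearrangements. *)
Lemma perm_swap_ind (T : eqType) (P : seq T -> Prop) :
    (forall s x y t, P (s ++ x :: y :: t) -> P (s ++ y :: x :: t)) ->
  forall s t, perm_eq s t -> P s -> P t.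
Proof.
move=> Psw.
have mv s : forall u x t, P (u ++ s ++ x :: t) -> P (u ++ x :: s ++ t).
  elim: s => [|y s IH] u x t //= Pu.
  by apply: Psw; rewrite -cat_rcons; apply: IH; rewrite cat_rcons.
have blk s2 : forall u s1 s3, P (u ++ s1 ++ s2 ++ s3) -> P (u ++ s2 ++ s1 ++ s3).
  elim: s2 => [|x s2 IH] u s1 s3 //= Pu.
  by rewrite -cat_rcons; apply: IH; rewrite cat_rcons; apply: mv.
by apply: catCA_perm_ind => s1 s2 s3; exact: (blk s2 [::]).
Qed.

Definition altern (V : eqType) (A : zmodType) (f : seq V -> A) : Prop :=
  (forall s x y t, f (s ++ x :: y :: t) = - f (s ++ y :: x :: t)) /\
  (forall s, ~~ uniq s -> f s = 0).

Section Altern.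
Variables (V : eqType) (A : zmodType).
Implicit Types (f g : seq V -> A) (s t : seq V).

Lemma nuniq_perm s : ~~ uniq s -> exists x t, perm_eq s (x :: x :: t).
Proof.
elim: s => //= y s IH; rewrite negb_and negbK => /orP[ys|/IH[x [t st]]].
  by exists y, (rem y s); rewrite perm_cons perm_to_rem.
exists x, (y :: t); rewrite -(perm_cons y) in st; apply: perm_trans st _.
by rewrite (perm_catCA [:: y] [:: x]) /= perm_cons (perm_catCA [:: y] [:: x]).
Qed.

(** Equal entries can be moved to the head. If 2 is a zero divisor, the vanishing
    on repetitions does not follow from the sign rule. *)
Lemma alternI f :
    (forall s x y t, f (s ++ x :: y :: t) = - f (s ++ y :: x :: t)) ->
  (forall x t, f (x :: x :: t) = 0) -> altern f.
Proof.
move=> fN fxx; split=> // s /nuniq_perm[x [t st]].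
rewrite perm_sym in st.
apply: (@perm_swap_ind _ (fun u => f u = 0) _ _ _ st); last exact: fxx.
by move=> u a b v E; rewrite fN E oppr0.
Qed.

Lemma altern_consP f x : altern f -> altern (fun s => f (x :: s)).
Proof.
move=> [fN f0]; split=> [s y z t|s ns]; first exact: (fN (x :: s)).
by apply: f0; rewrite /= negb_and ns orbT.
Qed.

(** The alternating sum over the deletions of an entry in [p], by recursion on the
    first entry. With [predT] it is the coboundary; with [pred1 v], which deletes
    [v], it is the cone with apex [v] on a chain. *)
Fixpoint cobd (p : pred V) f s : A :=
  if s is x :: s' then f s' *+ p x - cobd p (fun t => f (x :: t)) s' else 0.

Lemma cobd_ext p f g s :
  (forall u x v, s = u ++ x :: v -> f (u ++ v) = g (u ++ v)) ->
  cobd p f s = cobd p g s.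
Proof.
elim: s f g => [//|x s IH] f g fg /=; congr (_ *+ _ - _).
  exact: (fg [::] x s).
by apply: IH => u y v E; apply: (fg (x :: u) y v); rewrite E.
Qed.

Lemma cobd0 p f s :
  (forall u x v, s = u ++ x :: v -> f (u ++ v) = 0) -> cobd p f s = 0.
Proof.
move=> f0; rewrite (cobd_ext p (g := fun=> 0)) //.
by elim: s {f0} => //= x s ->; rewrite mul0rn subr0.
Qed.

Lemma cobdD p f g s : cobd p (fun t => f t + g t) s = cobd p f s + cobd p g s.
Proof.
by elim: s f g => [|x s IH] f g /=; rewrite ?addr0 // IH mulrnDl opprD addrACA.
Qed.

Lemma cobdN p f s : cobd p (fun t => - f t) s = - cobd p f s.
Proof.
by elim: s f => [|x s IH] f /=; rewrite ?oppr0 // IH mulNrn opprD.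
Qed.

Lemma cobdB p f g s : cobd p (fun t => f t - g t) s = cobd p f s - cobd p g s.
Proof. by rewrite cobdD cobdN. Qed.

Lemma cobd_sum p (I : Type) (r : seq I) (F : I -> seq V -> A) s :
  cobd p (fun t => \sum_(i <- r) F i t) s = \sum_(i <- r) cobd p (F i) s.
Proof.
elim: r => [|i r IH]; first by rewrite big_nil cobd0 // => *; rewrite big_nil.
rewrite big_cons -IH -cobdD; apply: cobd_ext => u x v _.
by rewrite big_cons.
Qed.

Lemma cobd_cobd f s : cobd predT (cobd predT f) s = 0.
Proof.
elim: s f => [//|x s IH] f /=.
by rewrite cobdB IH subr0 !mulr1n subrr.
Qed.

Lemma altern_cobd p f : altern f -> altern (cobd p f).
Proof.
move=> fA; apply: alternI => [s|x t /=]; last first.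
  rewrite opprB addrC subrK; apply: cobd0 => u y v _.
  by apply: fA.2; rewrite /= inE eqxx.
elim: s f fA => [|z s IH] f fA x y t; rewrite /=; last first.
  rewrite IH; last exact: altern_consP.
  by rewrite (fA.1 s) mulNrn opprD opprK.
rewrite (cobd_ext p (g := fun u => - f (y :: x :: u))); last first.
  by move=> u z v _; rewrite (fA.1 [::]).
by rewrite cobdN !opprD !opprK addrA addrAC [- _ + _]addrC.
Qed.

End Altern.

Lemma altern_eq_perm (V : eqType) (A : zmodType) (f g : seq V -> A) s t :
  altern f -> altern g -> perm_eq s t -> f s = g s -> f t = g t.
Proof.
move=> [fN _] [gN _] st; apply: (@perm_swap_ind _ (fun u => f u = g u) _ _ _ st).
by move=> u x y v E; rewrite fN E gN opprK.
Qed.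

Lemma altern_scale (S : comNzRingType) (W : eqType) (a : S) (f : seq W -> S^o) :
  altern f -> altern (fun t => a * f t : S^o).
Proof.
move=> [fN f0]; split=> [s x y t|s ns]; last by rewrite f0 // mulr0.
rewrite fN; exact: mulrN.
Qed.

Lemma cobd_neq0 (V : eqType) (A : zmodType) p (f : seq V -> A) s :
  cobd p f s != 0 -> exists u x v, s = u ++ x :: v /\ f (u ++ v) != 0.
Proof.
move=> fs; apply: contrapT => nex; case/negP: fs; apply/eqP/cobd0 => u x v sE.
by apply/eqP/negPn/negP => fuv; apply: nex; exists u, x, v.
Qed.

Lemma cobd_map (V W : eqType) (A : zmodType) (h : V -> W) (f : seq W -> A) s :
  cobd predT f (map h s) = cobd predT (fun u => f (map h u)) s.
Proof. by elim: s f => [//|x s IH] f /=; rewrite IH. Qed.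

Lemma cobdZ (R : pzRingType) (V : eqType) (W : lmodType R) p a (f : seq V -> W) s :
  cobd p (fun t => a *: f t) s = a *: cobd p f s.
Proof.
elim: s f => [|x s IH] f /=; first by rewrite scaler0.
by rewrite IH scalerBr scalerMnr.
Qed.

Lemma cobd_mulr (R : comNzRingType) (V : eqType) p (f : seq V -> R^o) (a : R) s :
  cobd p (fun t => f t * a : R^o) s = cobd p f s * a.
Proof.
transitivity (cobd p (fun t => a *: f t) s).
  by apply: cobd_ext => *; exact: mulrC.
by rewrite cobdZ; exact: mulrC.
Qed.

Section AlternProduct.
Variables (V : choiceType) (R : comNzRingType).
Implicit Types (f g : seq V -> R) (s t : seq V).

(** The two signs of a rearrangement cancel in a product; this gives access to
    the sign of a permutation without naming it. *)
Lemma altern_mul f g s t :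
  altern f -> altern g -> perm_eq s t -> f s * g s = f t * g t.
Proof.
move=> [fN _] [gN _] st.
apply: (@perm_swap_ind _ (fun u => f s * g s = f u * g u) _ _ _ st) => //.
by move=> u x y v ->; rewrite fN gN mulrNN.
Qed.

Fixpoint inversions (s : seq nat) : nat :=
  if s is x :: s' then count (gtn x) s' + inversions s' else 0.

(** The sign of the permutation that sorts [s] into the default enumeration of the
    set of its entries. It is an alternating function with invertible values, so
    that alternating functions amount to functions of finite sets. *)
Definition sgn s : R :=
  if uniq s then
    (-1) ^+ inversions (map (index^~ (enum_fset [fset x in s]%fset)) s) else 0.

Lemma inversions_swap (s t : seq nat) x y : x != y ->
  (-1) ^+ inversions (s ++ x :: y :: t) =
  - (-1) ^+ inversions (s ++ y :: x :: t) :> R.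
Proof.
move=> xy; elim: s => [|z s IH] /=; last first.
  rewrite !exprD IH mulrN !count_cat /=; congr (- (_ ^+ _ * _)).
  by rewrite [X in (_ + X)%N]addnCA.
case: (ltngtP x y) xy => // _ _; rewrite !(add0n, add1n) !exprD ?exprS.
  by rewrite mulN1r mulNr opprK mulrCA.
by rewrite mulN1r mulNr mulrCA.
Qed.

Lemma fset_seq_single (x : V) : [fset y in [:: x]]%fset = [fset x]%fset.
Proof. by apply/fsetP => y; rewrite !inE orbF. Qed.

Lemma fset_seq_perm s t : perm_eq s t -> ([fset x in s] = [fset x in t])%fset.
Proof. by move=> /perm_mem st; apply/fsetP => x; rewrite !inE st. Qed.

Lemma perm_enum_fset s : uniq s -> perm_eq s (enum_fset [fset x in s]%fset).
Proof.
by move=> us; apply: uniq_perm => // x; rewrite !inE.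
Qed.

Lemma altern_sgn : altern sgn.
Proof.
apply: alternI => [s x y t|x t]; last by rewrite /sgn /= inE eqxx.
have st := swap_perm s t x y.
rewrite /sgn (perm_uniq st) (fset_seq_perm st).
have [us|_] := boolP (uniq _); last by rewrite oppr0.
rewrite !map_cat /= inversions_swap //.
set e := enum_fset _.
have xe : x \in e by rewrite -(perm_mem (perm_enum_fset us)) mem_cat !inE eqxx /= !orbT.
have ye : y \in e by rewrite -(perm_mem (perm_enum_fset us)) mem_cat !inE eqxx /= !orbT.
apply: contraL us => /eqP E.
rewrite -(nth_index x xe) E nth_index //.
by rewrite cat_uniq /= inE eqxx !andbF.
Qed.

Lemma sgn_sqr s : uniq s -> sgn s * sgn s = 1.
Proof. by move=> us; rewrite /sgn us -exprD addnn -mul2n exprM sqrrN !expr1n. Qed.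

Lemma altern_enum f s : altern f -> uniq s ->
  f s = sgn s * (sgn (enum_fset [fset x in s]%fset) *
                 f (enum_fset [fset x in s]%fset)).
Proof.
move=> fA us; rewrite (altern_mul altern_sgn fA (t := s)); last first.
  by rewrite perm_sym perm_enum_fset.
by rewrite mulrA sgn_sqr // mul1r.
Qed.

End AlternProduct.

Lemma coboundary_cobd (R : comNzRingType) (V : choiceType) (L : complex V)
    (f : seq V -> R^o) s :
  coboundary L f s = if `[< ordered_simplex L s >] then cobd predT f s else 0.
Proof.
rewrite /coboundary; case: asboolP => // _.
elim: s f => [|x s IH] f; first by rewrite big_ord0.
rewrite big_ord_recl expr0 mul1r /= drop0 -IH -sumrN; congr (_ + _).
by apply: eq_bigr => i _; rewrite /bump /= add1n exprS mulN1r mulNr.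
Qed.

(** * Supports and boundaries *)

(** Finite support, for alternating functions, is support in the sequences of
    elements of a finite set; the sums defining boundaries of several functions
    then range over one finite set. *)
Definition supp_in (V : choiceType) (A : zmodType) (B : {fset V})
    (f : seq V -> A) : Prop :=
  forall s x, x \in s -> x \notin B -> f s = 0.

(** The boundary of an augmented chain: at the empty sequence it is the sum of the
    coefficients, and on the chains of a star there is no special case. *)
Definition bd (V : choiceType) (A : zmodType) (f : seq V -> A) (s : seq V) : A :=
  \sum_(x \in [set: V]) f (x :: s).

Section Boundary.
Variables (V : choiceType) (A : zmodType).
Implicit Types (f g : seq V -> A) (s t : seq V) (B : {fset V}).

Lemma supp_in_sub B C f : (B `<=` C)%fset -> supp_in B f -> supp_in C f.
Proof.
move=> /fsubsetP BC fB s x xs xC; apply: (fB s x) => //.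
by apply: contra xC => /BC.
Qed.

Lemma bdE B f s : supp_in B f -> bd f s = \sum_(x <- B) f (x :: s).
Proof.
by move=> fB; apply: fsbigTE => x; apply: fB; rewrite inE eqxx.
Qed.

Lemma bd0 f s : (forall x, f (x :: s) = 0) -> bd f s = 0.
Proof. by move=> f0; apply: fsbig1 => x _. Qed.

Lemma bd_ext f g s : (forall x, f (x :: s) = g (x :: s)) -> bd f s = bd g s.
Proof. by move=> fg; apply: eq_fsbigr => x _. Qed.

Lemma supp_in_bd B f : supp_in B f -> supp_in B (bd f).
Proof.
move=> fB s x xs xB; apply: bd0 => y; apply: (fB _ x) => //.
by rewrite inE xs orbT.
Qed.

Lemma supp_in_cobd B p f : {in predC (mem B), forall x, ~~ p x} ->
  supp_in B f -> supp_in B (cobd p f).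
Proof.
move=> pB; have H s : forall f x, (forall u, x \in u -> f u = 0) ->
    x \notin B -> x \in s -> cobd p f s = 0.
  elim: s => //= y s IH {}f x f0 xB; rewrite inE => /orP[/eqP <-|xs].
    rewrite (negbTE (pB _ _)) // mulr0n sub0r cobd0 ?oppr0 // => u z v _.
    by apply: f0; rewrite inE eqxx.
  rewrite f0 // mul0rn sub0r (IH _ x) ?oppr0 // => u xu.
  by apply: f0; rewrite inE xu orbT.
by move=> fB s x xs xB; apply: (H _ _ x) => // u xu; apply: (fB u x).
Qed.

Lemma altern_bd B f : supp_in B f -> altern f -> altern (bd f).
Proof.
move=> fB fA; split=> [s x y t|s ns]; last first.
  by apply: bd0 => x; rewrite fA.2 //= negb_and ns orbT.
rewrite !(bdE _ fB) -sumrN; apply: eq_bigr => z _.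
exact: (fA.1 (z :: s)).
Qed.

(** The diagonal vanishes by assumption, since 2 may be a zero divisor. *)
Lemma sum_antisym (F : V -> V -> A) (r : seq V) :
  (forall x y, F x y = - F y x) -> (forall x, F x x = 0) ->
  \sum_(x <- r) \sum_(y <- r) F x y = 0.
Proof.
move=> FN F0; elim: r => [|z r IH]; first by rewrite big_nil.
rewrite big_cons big_cons F0 add0r.
under [X in _ + X]eq_bigr do rewrite big_cons.
rewrite big_split /= IH addr0 -big_split /= big1 // => x _.
by rewrite FN addNr.
Qed.

Lemma bd_bd B f s : supp_in B f -> altern f -> bd (bd f) s = 0.
Proof.
move=> fB fA; rewrite (bdE _ (supp_in_bd fB)).
under eq_bigr do rewrite (bdE _ fB).
apply: (@sum_antisym (fun x y => f (y :: x :: s))) => [x y|x].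
  exact: (fA.1 [::]).
by apply: fA.2; rewrite /= inE eqxx.
Qed.

(** Summing over the first entry is linear, and [cobd] only combines values of
    its argument: this is why boundaries in one variable commute with
    coboundaries in another. *)
Lemma bd_cobd2 B p (F : seq V -> seq V -> A) s t :
  (forall u, supp_in B (F u)) ->
  bd (fun t => cobd p (F^~ t) s) t = cobd p (fun u => bd (F u) t) s.
Proof.
move=> FB; rewrite (@bdE B); last first.
  by move=> u x xu xB; apply: cobd0 => *; apply: FB xu xB.
rewrite -cobd_sum; apply: cobd_ext => u x v _.
by rewrite (bdE _ (FB _)).
Qed.

(** Adding the vertex [v] in front undoes its deletion and commutes with the other
    ones: coning off is a contraction. *)
Lemma bd_cone B v f s : supp_in B f ->
  bd (cobd (pred1 v) f) s = f s - cobd (pred1 v) (bd f) s.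
Proof.
move=> fB; have {}fB := supp_in_sub (fsubsetUr [fset v]%fset B) fB.
rewrite (bdE _ (supp_in_cobd _ fB)); last first.
  by move=> x; rewrite !inE negb_or => /andP[].
rewrite /= sumrB; congr (_ - _).
  rewrite (big_fsetD1 v) ?inE ?eqxx //= mulr1n big1_fset ?addr0 // => x.
  by rewrite !inE => /andP[/negbTE -> _].
by rewrite -cobd_sum; apply: cobd_ext => u x w _; rewrite (bdE _ fB).
Qed.

Lemma fin_supported_supp f : fin_supported f -> exists B, supp_in B f.
Proof.
move=> ff; exists (\bigcup_(s <- fset_set [set s | f s != 0]) [fset x in s])%fset.
move=> s x xs; apply: contraNeq => fs.
apply/bigfcupP; exists s; last by rewrite inE.
by rewrite andbT in_fset_set // inE.
Qed.

Lemma supp_fin_supported B f : supp_in B f -> altern f -> fin_supported f.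
Proof.
move=> fB fA; pose r := flatten [seq permutations (enum_fset C) | C <- fpowerset B].
apply: (@sub_finite_set _ _ [set` r]); last exact: finite_seq.
move=> s /= fs; have us : uniq s by apply: contraNT fs => /fA.2 ->.
suff: s \in r by [].
apply/flattenP; exists (permutations (enum_fset [fset x in s]%fset)).
  apply: (map_f (fun C : {fset V} => permutations (enum_fset C))).
  rewrite fpowersetE; apply/fsubsetP => x; rewrite !inE => xs.
  by apply: contraNT fs => xB; rewrite (fB s x).
by rewrite mem_permutations; exact: perm_enum_fset.
Qed.

End Boundary.

Lemma bd_two (V : choiceType) (A : zmodType) (f : seq V -> A) s x y : x != y ->
  (forall z, z != x -> z != y -> f (z :: s) = 0) ->
  bd f s = f (x :: s) + f (y :: s).
Proof.
move=> xy f0; rewrite /bd (@fsbigTE _ _ _ _ [fset x; y]%fset) /=.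
  by rewrite big_fsetU1 ?inE //= big_seq_fset1.
by move=> z; rewrite !inE negb_or => /andP[]; exact: f0.
Qed.

Lemma bd_one (V : choiceType) (A : zmodType) (f : seq V -> A) s x :
  (forall z, z != x -> f (z :: s) = 0) -> bd f s = f (x :: s).
Proof.
move=> f0; rewrite /bd (@fsbigTE _ _ _ _ [fset x]%fset) /= ?big_seq_fset1 //.
by move=> z; rewrite !inE; exact: f0.
Qed.

Lemma bd_neq0 (V : choiceType) (A : zmodType) (f : seq V -> A) s :
  bd f s != 0 -> exists x, f (x :: s) != 0.
Proof.
move=> fs; apply: contrapT => nex; case/negP: fs; apply/eqP/bd0 => x.
by apply/eqP/negPn/negP => fx; apply: nex; exists x.
Qed.

(** * Numbers of generators *)

(** The bound on the number of generators is what survives an unspecified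
    isomorphism of homology modules. *)
Definition generated (R : pzRingType) (r : nat) (M : lmodType R) : Prop :=
  exists e : 'I_r -> M, forall x, exists a : 'I_r -> R, x = \sum_i a i *: e i.

Lemma generated_iso (R : pzRingType) r (M N : lmodType R) :
  lmod_iso M N -> generated r M <-> generated r N.
Proof.
move=> [f [g fK gK]]; split=> -[e eP].
  exists (f \o e) => y; have [a ya] := eP (g y); exists a.
  by rewrite -[y]gK ya linear_sum; apply: eq_bigr => i _; rewrite linearZ.
exists (g \o e) => x; have [a xa] := eP (f x); exists a.
apply: (can_inj fK); rewrite xa linear_sum; apply: eq_bigr => i _.
by rewrite linearZ /= gK.
Qed.

Section Generated.
Variables (R : pzRingType) (W : lmodType R) (Z B : submodule W).

Lemma smemB (S : submodule W) x y : S x -> S y -> S (x - y).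
Proof.
move=> Sx Sy; rewrite addrC -scaleN1r; exact: smemP.
Qed.

Lemma smemZ (S : submodule W) a x : S x -> S (a *: x).
Proof. by move=> Sx; rewrite -[_ *: _]addr0; apply: smemP => //; exact: smem0. Qed.

Lemma generated_subquotient r : generated r (subquotient Z B) <->
  exists e : 'I_r -> W, (forall i, Z (e i)) /\
    forall z, Z z -> exists a : 'I_r -> R, B (z - \sum_i a i *: e i).
Proof.
have clE (e : 'I_r -> sub_of Z) (a : 'I_r -> R) :
    \sum_i a i *: sq_class B (e i) = sq_class B (\sum_i a i *: e i).
  by rewrite /sq_class linear_sum; apply: eq_bigr => i _; rewrite linearZ.
have vE (e : 'I_r -> sub_of Z) (a : 'I_r -> R) :
    val (\sum_i a i *: e i) = \sum_i a i *: val (e i).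
  by rewrite linear_sum; apply: eq_bigr => i _; rewrite linearZ.
split=> [[e eP]|[e [Ze eP]]].
  exists (fun i => val (sq_repr (e i))); split=> [i|z Zz].
    by apply/smpredP; exact: valP.
  have z' : z \in smpred Z by apply/smpredP.
  have [a za] := eP (sq_class B (SubOf z')); exists a.
  move: za; under eq_bigr do rewrite -[e _]sq_reprK.
  by rewrite clE => /sq_classP; rewrite vE.
have Ze' i : e i \in smpred Z by apply/smpredP.
exists (fun i => sq_class B (SubOf (Ze' i))) => q.
have [|a za] := eP (val (sq_repr q)); first by apply/smpredP; exact: valP.
by exists a; rewrite clE -[LHS]sq_reprK; apply/sq_classP; rewrite vE.
Qed.

End Generated.

(** Padded with zeros, both factors become square matrices of determinant 0. *)
Lemma det_factor (R : comNzRingType) r (A : 'M[R]_(r + 1, r)) (C : 'M[R]_(r, r + 1)) :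
  A *m C != 1%:M.
Proof.
apply/negP => /eqP AC.
have : \det (row_mx A (0 : 'cV_(r + 1)) *m col_mx C (0 : 'rV_(r + 1))) = 1.
  by rewrite mul_row_col mul0mx addr0 AC det1.
rewrite det_mulmx (expand_det_col _ (rshift r ord0)) big1 ?mul0r.
  by move/eqP; rewrite eq_sym oner_eq0.
by move=> i _; rewrite row_mxEr mxE mul0r.
Qed.

(** Evaluation at the points [x i] is a family of functionals dual to the [z j].
    With [r] generators, the identity matrix of size [r + 1] would factor through
    a free module of rank [r]. *)
Lemma not_generated (R : comNzRingType) (T : Type) (Z B : submodule (T -> R^o))
    r (x : 'I_(r + 1) -> T) (z : 'I_(r + 1) -> T -> R^o) :
  (forall j, Z (z j)) -> (forall b i, B b -> b (x i) = 0) ->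
  (forall i j, z j (x i) = (i == j)%:R) -> ~ generated r (subquotient Z B).
Proof.
move=> Zz Bx zx /generated_subquotient[e [_ eP]].
have [a aP] := choice (fun j => eP _ (Zz j)).
have := det_factor (\matrix_(i, k) (e k (x i) : R)) (\matrix_(k, j) a j k).
move=> /eqP; apply; apply/matrixP => i j; rewrite !mxE.
have := Bx _ i (aP j); rewrite !fctE zx => /eqP.
rewrite subr_eq0 => /eqP ->; rewrite fct_sumE.
by apply: eq_bigr => k _; rewrite !mxE mulrC.
Qed.

(** * Homology of spheres *)

Lemma scale1o (R : pzRingType) (a : R) : a *: (1 : R^o) = a.
Proof. exact: mulr1. Qed.

Section Generated01.
Variables (R : comNzRingType) (W : lmodType R) (Z B : submodule W).

Lemma generated0P : generated 0 (subquotient Z B) <-> forall z, Z z -> B z.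
Proof.
split=> [/generated_subquotient[e [_ eP]] z Zz|ZB].
  by have [a] := eP z Zz; rewrite big_ord0 subr0.
apply/generated_subquotient; exists (fun=> 0); split=> [i|z Zz]; first exact: smem0.
by exists (fun=> 0); rewrite big_ord0 subr0; exact: ZB.
Qed.

Lemma generated1P : generated 1 (subquotient Z B) <->
  exists2 e, Z e & forall z, Z z -> exists a, B (z - a *: e).
Proof.
split=> [/generated_subquotient[e [Ze eP]]|[e Ze eP]].
  exists (e ord0) => // z Zz; have [a] := eP z Zz; rewrite big_ord1.
  by exists (a ord0).
apply/generated_subquotient; exists (fun=> e); split=> // z Zz.
by have [a Ba] := eP z Zz; exists (fun=> a); rewrite big_ord1.
Qed.

End Generated01.

Section Chains.
Variables (R : comNzRingType) (V : choiceType) (K : complex V).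
Implicit Types (c : seq V -> R^o) (s : seq V).

Lemma chainP k c : chain K k c <->
  [/\ altern c, exists B, supp_in B c &
      forall s, c s != 0 -> ordered_simplex K s /\ (size s)%:Z - 1 = k].
Proof.
split=> [[[c0 cN] fc]|[cA [B cB] cK]].
  split; last 2 first.
  - exact: fin_supported_supp.
  - by move=> s cs; apply: contrapT => /c0 E; rewrite E eqxx in cs.
  apply: alternI => // x t; apply: c0 => -[[/=]].
  by rewrite inE eqxx.
split; last exact: supp_fin_supported cB cA.
split; last exact: cA.1.
by move=> s nK; apply/eqP/negPn/negP => /cK.
Qed.

Lemma ordered_simplex_neq0 s : ordered_simplex K s -> s != [::].
Proof.
case: s => // -[_].
rewrite (_ : [fset x in [::]]%fset = fset0) => [/simplex_nonempty //|].
by apply/fsetP => x; rewrite !inE.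
Qed.

Lemma ordered_simplex_mem s : ordered_simplex K s -> exists x, x \in s.
Proof.
move/ordered_simplex_neq0; case: s => // x s _.
by exists x; rewrite inE eqxx.
Qed.

Lemma fset_seq_eq0 s : ([fset x in s]%fset == fset0) = (s == [::]).
Proof.
case: s => [|x s]; first by apply/eqP/fsetP => x; rewrite !inE.
by apply/eqP => /fsetP/(_ x); rewrite !inE eqxx.
Qed.

Lemma ordered_simplex_sub s t : ordered_simplex K t -> s != [::] -> uniq s ->
  {subset s <= t} -> ordered_simplex K s.
Proof.
move=> [_ Kt] s0 us st; split=> //; apply: simplex_face Kt _ _.
  by apply/fsubsetP => x; rewrite !inE; exact: st.
by rewrite fset_seq_eq0.
Qed.

Lemma boundary_bd k c s : chain K k c -> k != 0 -> boundary c s = bd c s.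
Proof.
move=> /chainP[_ _ cK] k0; case: s => //.
rewrite /= bd0 // => x; apply/eqP/negPn/negP => /cK[_ /= kE].
by case/negP: k0; rewrite -kE.
Qed.

(** The coefficients of a boundary have sum 0, by [bd_bd] at the empty sequence. *)
Lemma boundaries_augmentation c : boundaries R K 0 c -> bd c [::] = 0.
Proof.
move=> [d /chainP[dA [B dB] _] ->].
by rewrite -[RHS](bd_bd [::] dB dA); apply: bd_ext.
Qed.

Definition vertex_chain (v : V) : seq V -> R^o := fun s => (s == [:: v])%:R.

Lemma vertex_chain_cycle v : K [fset v]%fset -> cycles R K 0 (vertex_chain v).
Proof.
move=> Kv; split.
  apply/chainP; split.
  - apply: alternI => [s x y t|x t]; rewrite /vertex_chain; last first.
      by rewrite eqseq_cons andbF.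
    by case: s => [|a [|b s]]; rewrite /= !eqseq_cons ?andbF oppr0.
  - exists [fset v]%fset => s x xs; rewrite inE /vertex_chain => xv.
    by case: (s =P _) xs => // ->; rewrite inE (negbTE xv).
  move=> s; rewrite /vertex_chain; case: (s =P _) => [-> _|]; rewrite ?eqxx //=; split=> //.
  by split=> //; rewrite fset_seq_single.
apply/funext => -[|x s] //; apply: bd0 => y; rewrite /vertex_chain.
by rewrite eqseq_cons andbF.
Qed.

Lemma bd_vertex_chain v : bd (vertex_chain v) [::] = 1.
Proof.
rewrite (@bdE _ _ [fset v]%fset) ?big_seq_fset1 /vertex_chain ?eqxx // => s x xs xv.
by rewrite inE in xv; case: (s =P _) xs => // ->; rewrite inE (negbTE xv).
Qed.

Lemma not_generated0_H0 v : K [fset v]%fset -> ~ generated 0 (homology R K 0).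
Proof.
move=> Kv /generated0P/(_ _ (vertex_chain_cycle Kv))/boundaries_augmentation/eqP.
by rewrite bd_vertex_chain oner_eq0.
Qed.

End Chains.

Lemma size_dimP (a k : nat) : a%:Z - 1 = k%:Z <-> a = k.+1.
Proof. lia. Qed.

Section Sphere.
Variables (R : comNzRingType) (m : nat).
Local Notation S := (sphere m%:Z).
Implicit Types (s : seq 'I_m.+2) (c : seq 'I_m.+2 -> R^o).

Lemma sphere_simplexP s :
  ordered_simplex S s <-> [/\ uniq s, s != [::] & (size s < m.+2)%N].
Proof.
split=> [[us [s0 [x xs]]]|[us s0 ss]].
  split=> //; first by rewrite -fset_seq_eq0.
  have uxs : uniq (x :: s) by rewrite /= us andbT; rewrite inE in xs.
  by have := max_card (mem (x :: s)); rewrite (card_uniqP uxs) card_ord.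
split=> //; split; first by rewrite fset_seq_eq0.
apply: contrapT => nx; have : (#|'I_m.+2| <= #|s|)%N.
  apply: subset_leq_card; apply/fintype.subsetP => x _; apply/negPn/negP => xs.
  by apply: nx; exists x; rewrite inE.
by rewrite card_ord (card_uniqP us) leqNgt ss.
Qed.

(** Coning off a vertex stays in the sphere as long as the dimension of the result
    is at most [m], only the full simplex being absent. *)
Lemma cone_chain (k : nat) c v : chain S k%:Z c -> (k < m)%N ->
  chain S (k%:Z + 1) (cobd (pred1 v) c).
Proof.
move=> /chainP[cA [B cB] cS] km; have bA := altern_cobd (pred1 v) cA.
apply/chainP; split=> //.
  exists (v |` B)%fset; apply: supp_in_cobd; last first.
    by apply: supp_in_sub cB; exact: fsubsetUr.
  by move=> x; rewrite !inE negb_or => /andP[].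
move=> s bs; have us : uniq s by apply: contraNT bs => /bA.2 ->.
have [u [x [w [sE /cS[_ kE]]]]] := cobd_neq0 bs.
have szk : size s = k.+2.
  have szu := (size_dimP _ _).1 kE.
  by rewrite sE !size_cat /= addnS -size_cat szu.
split; last by rewrite szk; lia.
by apply/sphere_simplexP; split=> //; [case: (s) szk | rewrite szk; lia].
Qed.

Lemma sphere_homology_mid (k : nat) :
  (0 < k < m)%N -> generated 0 (homology R S k%:Z).
Proof.
move=> /andP[k0 km]; apply/generated0P => c [cS bc].
have k0' : k%:Z != 0 by lia.
exists (cobd (pred1 ord0) c); first exact: cone_chain.
apply/funext => s; rewrite (boundary_bd s (cone_chain ord0 cS km)); last by lia.
have /chainP[_ [B cB] _] := cS.
rewrite (bd_cone _ _ cB) cobd0 ?subr0 // => u x w _.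
by rewrite -(boundary_bd _ cS k0') bc.
Qed.

(** The cone on a 0-chain fills it up to a multiple of its apex. *)
Lemma sphere_homology0 : (0 < m)%N -> generated 1 (homology R S 0).
Proof.
move=> m0; apply/generated1P; exists (vertex_chain R ord0).
  apply: vertex_chain_cycle; split.
    by apply/eqP => /fsetP/(_ ord0); rewrite !inE eqxx.
  by exists ord_max; rewrite inE.
move=> c [cS bc]; exists (bd c [::]).
have cS0 : chain S 0%N c by [].
exists (cobd (pred1 ord0) c); first exact: (cone_chain ord0 cS0 m0).
have /chainP[_ [B cB] cS1] := cS.
apply/funext => -[|x s].
  rewrite !fctE /vertex_chain scaler0 subr0 /=.
  apply/eqP/negPn/negP => /cS1[/ordered_simplex_neq0].
  by rewrite eqxx.
rewrite (boundary_bd _ (cone_chain ord0 cS0 m0)) // (bd_cone _ _ cB).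
rewrite !fctE; congr (_ - _); rewrite /= /vertex_chain eqseq_cons.
have bc0 y t : bd c (y :: t) = 0 by exact: (congr1 (fun f => f (y :: t)) bc).
rewrite cobd0 => [|[|y u] z w _]; [|exact: bc0|exact: bc0].
case: s => [|y s]; first by rewrite subr0 andbT; case: eqP; rewrite ?scaler0 ?scale1o.
by rewrite bc0 andbF mul0rn subr0 scaler0.
Qed.

(** The cone on a top cycle is a multiple of the full simplex, so the cycle is a
    multiple of its boundary. *)
Lemma sphere_homology_top : (0 < m)%N ->
  generated 1 (homology R S m%:Z).
Proof.
move=> m0; have m0' : m%:Z != 0 by lia.
pose U := [fset x in enum 'I_m.+2]%fset.
have inU x : x \in U by rewrite inE mem_enum.
have suppU (f : seq 'I_m.+2 -> R^o) : supp_in U f by move=> s x _; rewrite inU.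
pose w s : R^o := if size s == m.+2 then sgn R s else 0.
have wA : altern w.
  have [gN g0] := altern_sgn 'I_m.+2 R.
  split=> [s x y t|s ns]; rewrite /w; last by rewrite g0 // if_same.
  by rewrite gN !size_cat /=; case: ifP => _; rewrite ?oppr0.
have wc : cycles R S m%:Z (bd w).
  split; last first.
    by apply/funext => -[|x s] //; rewrite -[RHS](bd_bd (x :: s) (suppU w) wA).
  apply/chainP; split; [exact: altern_bd (suppU w) wA | by exists U |].
  move=> s /bd_neq0[x]; rewrite /w /=; case: (_.+1 =P _) => [[ss]|]; last by rewrite eqxx.
  have [uxs _|nxs] := boolP (uniq (x :: s)); last first.
    by rewrite (altern_sgn _ _).2 ?eqxx.
  split; last by rewrite ss; lia.
  apply/sphere_simplexP; rewrite ss; split=> //; first by case/andP: uxs.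
  by case: (s) ss.
apply/generated1P; exists (bd w) => // c [cS bc].
pose b := cobd (pred1 ord0) c; have [cA _ cS1] := (chainP _ _ _).1 cS.
pose E := enum_fset U; exists (sgn R E * b E).
have bE s : b s = (sgn R E * b E) * w s.
  have bA : altern b := altern_cobd (pred1 ord0) cA.
  rewrite /w; have [us|ns] := boolP (uniq s); last first.
    by rewrite bA.2 // ((altern_sgn _ _).2 s) // if_same mulr0.
  case: eqP => [ss|ss]; last first.
    rewrite mulr0; apply/eqP/negPn/negP => /cobd_neq0[u [x [v [sE /cS1[_ uv]]]]].
    by apply: ss; move: uv; rewrite sE !size_cat /=; lia.
  rewrite (altern_enum bA us) mulrC; congr (_ * _); rewrite /E.
  suff -> : [fset x in s]%fset = U by [].
  apply/fsetP => x; rewrite inU inE; apply/negPn/negP => xs.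
  have uxs : uniq (x :: s) by rewrite /= us andbT.
  by have := max_card (mem (x :: s)); rewrite (card_uniqP uxs) card_ord /= ss ltnn.
suff -> : c = (sgn R E * b E) *: bd w by rewrite subrr; exact: smem0.
apply/funext => s; rewrite !fctE (bdE _ (suppU w)).
have := bd_cone ord0 s (suppU c); rewrite [X in _ - X]cobd0 ?subr0 => [<-|u x v _].
  rewrite (bdE _ (suppU _)) scaler_sumr; apply: eq_bigr => x _.
  by rewrite -[LHS]/(b (x :: s)) bE.
by rewrite -(boundary_bd _ cS m0') bc.
Qed.

End Sphere.

(** The 0-sphere has no edges, so its homology is free on its two points. *)
Lemma sphere0_homology0 (R : comNzRingType) :
  generated 2 (homology R (sphere 0) 0) /\ ~ generated 1 (homology R (sphere 0) 0).
Proof.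
have S1 (x : 'I_2) : sphere 0 [fset x]%fset.
  split; first by apply/eqP => /fsetP/(_ x); rewrite !inE eqxx.
  by exists (rev_ord x); case: x => -[|[]] // ?; rewrite inE.
have B0 b s : boundaries R (sphere 0) 0 b -> b s = 0.
  move=> [d /chainP[_ _ dS] ->]; case: s => // x s; apply: bd0 => y.
  apply/eqP/negPn/negP => /dS[/(sphere_simplexP (m := 0))[_ _] /=].
  by lia.
split; last first.
  apply: (@not_generated _ _ _ _ 1 (fun i => [:: i]) (fun j => vertex_chain R j)) => [j|b i|i j].
  - exact: vertex_chain_cycle.
  - exact: B0.
  - by rewrite /vertex_chain eqseq_cons andbT.
apply/generated_subquotient; exists (@vertex_chain R _); split=> [i|c [cS _]].
  exact: vertex_chain_cycle.
exists (fun i => c [:: i]); rewrite (_ : _ - _ = 0); first exact: smem0.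
have /chainP[_ _ cS1] := cS.
apply/funext => s; rewrite !fctE fct_sumE; apply/eqP; rewrite subr_eq0; apply/eqP.
have [[x ->]|s1] : (exists x, s = [:: x]) \/ (size s != 1%N).
  by case: (s) => [|x [|y u]]; [right|left; exists x|right].
  rewrite (bigD1 x) //= big1 => [|y yx]; rewrite !fctE /vertex_chain ?eqxx ?addr0.
    by rewrite scale1o.
  by rewrite eqseq_cons eq_sym (negbTE yx) scaler0.
rewrite big1 => [|x _]; last first.
  by rewrite !fctE /vertex_chain; case: (s =P _) s1 => [->|_ _]; rewrite ?eqxx ?scaler0.
apply/eqP/negPn/negP => /cS1[_ sE]; move/eqP: s1; apply.
by apply/size_dimP.
Qed.

Lemma sphere_neg_homology (R : comNzRingType) (m : nat) k :
  generated 0 (homology R (sphere (Negz m)) k).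
Proof.
apply/generated0P => c [[[c0 _] _] _]; exists 0.
  by split; [exact: alternating0 | exact: fin_supported0].
have -> : c = 0; last by apply/funext => -[|x s] //; rewrite /boundary fsbig1.
apply/funext => s; apply: c0 => -[/ordered_simplex_neq0]; case: s => // x.
by case: x.
Qed.

(** * Links in a homology manifold *)

Section Link.
Variables (V : choiceType) (L : complex V).
Implicit Types (s t : seq V).

(** Evaluating at [t ++ s] turns chains of the star into chains of the link, and
    commutes with boundaries because these look at the first entry. *)
Lemma link_simplexP s t : ordered_simplex L s -> t != [::] ->
  ordered_simplex (link L [fset x in s]%fset) t <-> ordered_simplex L (t ++ s).
Proof.
move=> [us Ls] t0; rewrite /ordered_simplex cat_uniq us andbT.
have -> : [fset x in t ++ s]%fset = ([fset x in t] `|` [fset x in s])%fset.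
  by apply/fsetP => x; rewrite !inE.
have dE : [disjoint [fset x in t] & [fset x in s]]%fset = ~~ has (mem t) s.
  apply/fdisjointP/hasPn => [ts x xs|ts x].
    by apply/negP => xt; have := ts x; rewrite !inE => /(_ xt)/negP; apply.
  by rewrite !inE => xt; apply/negP => /ts/negP; apply.
split=> [[ut [_ ts Lts]]|[/andP[ut ts] Lts]].
  by rewrite ut -dE ts.
by split=> //; split; rewrite ?fset_seq_eq0 ?dE.
Qed.

Lemma near_finite (B : {fset V}) : locally_finite L ->
  exists C : {fset V}, forall s x, ordered_simplex L s -> x \in s -> x \in B ->
    {subset s <= C}.
Proof.
move=> Lf; exists (\bigcup_(x <- B) \bigcup_(s <- fset_set [set s | L s /\ x \in s]) s)%fset.
move=> s x [_ Ls] xs xB y ys; apply/bigfcupP; exists x; rewrite ?xB //.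
apply/bigfcupP; exists [fset z in s]%fset; last by rewrite inE.
by rewrite andbT in_fset_set // inE /=; split; rewrite ?inE.
Qed.

End Link.

Section Manifold.
Variables (R : comNzRingType) (n : nat) (V : choiceType) (L : complex V).
Hypothesis Lmfd : homology_manifold R n L.
Implicit Types (s t : seq V).

Local Notation lk s := (link L [fset x in s]%fset).

Lemma link_homology s (m : int) r k : ordered_simplex L s -> n%:Z - (size s)%:Z = m ->
  generated r (homology R (lk s) k) <-> generated r (homology R (sphere m) k).
Proof.
move=> [us Ls] sE; apply: generated_iso.
have := Lmfd.2 _ Ls k; congr (lmod_iso _ (homology R (sphere _) k)).
by rewrite /Defs.dim card_fseq undup_id // -sE opprB addrCA addrAC subrr add0r.
Qed.

Lemma lk_vertex s x : ordered_simplex L s ->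
  lk s [fset x]%fset <-> ordered_simplex L (x :: s).
Proof.
move=> Ls; rewrite -(link_simplexP (t := [:: x]) Ls) // /ordered_simplex.
by rewrite fset_seq_single; split=> [|[]].
Qed.

(** A simplex of dimension greater than [n] would give a vertex to the link of an
    [n]-simplex, which has no homology. *)
Lemma simplex_size_le s : ordered_simplex L s -> (size s <= n.+1)%N.
Proof.
move=> Ls; rewrite leqNgt; apply/negP => ns.
pose k := (size s - n.+2)%N.
have [x [t tE]] : exists x t, drop k s = x :: t.
  have : size (drop k s) = n.+2 by rewrite size_drop /k; lia.
  by case: (drop k s) => // x t; exists x, t.
have sz : size (x :: t) = n.+2 by rewrite -tE size_drop /k; lia.
have Lxt : ordered_simplex L (x :: t).
  apply: (ordered_simplex_sub Ls) => //; rewrite -tE.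
    by apply: drop_uniq; case: Ls.
  by move=> y; exact: mem_drop.
have Lt : ordered_simplex L t.
  apply: (ordered_simplex_sub Lxt); first by case: (t) sz.
    by case: Lxt => /= /andP[].
  by move=> y yt; rewrite inE yt orbT.
have := @not_generated0_H0 R _ _ _ ((lk_vertex x Lt).2 Lxt).
apply; apply/(@link_homology _ (Negz 0)) => //; last exact: sphere_neg_homology.
by move: sz => /= [->]; lia.
Qed.

(** The link of a simplex of dimension less than [n] is not empty, having the
    homology of a sphere of nonnegative dimension. *)
Lemma coface s : ordered_simplex L s -> (size s <= n)%N ->
  exists x, ordered_simplex L (x :: s).
Proof.
move=> Ls sn; apply: contrapT => nx.
have : ~ generated 0 (homology R (lk s) 0).
  rewrite (@link_homology _ (Posz (n - size s)) _ _ Ls); last by lia.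
  apply: (@not_generated0_H0 _ _ _ ord0); split.
    by apply/eqP => /fsetP/(_ ord0); rewrite !inE eqxx.
  by exists ord_max; rewrite inE.
apply; apply/generated0P => c [/chainP[_ _ cK] _].
rewrite (_ : c = 0); first exact: smem0.
apply/funext => t; apply/eqP/negPn/negP => /cK[Kt tE].
have /size_dimP sz : (size t)%:Z - 1 = 0%N by [].
case: t Kt sz {tE} => [//|x [|//]] Kt _; apply: nx; exists x.
exact/(link_simplexP (t := [:: x]) Ls).
Qed.

Lemma purity s : ordered_simplex L s ->
  exists t, ordered_simplex L (t ++ s) /\ size (t ++ s) = n.+1.
Proof.
move=> Ls; have [k sk] : exists k, (n.+1 - size s)%N = k by eexists.
elim: k s Ls sk => [|k IH] s Ls sk.
  by exists [::]; split=> //; have := simplex_size_le Ls; move: sk => /=; lia.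
have [|x Lxs] := coface Ls; first by lia.
have [|t [Lt tE]] := IH _ Lxs; first by rewrite /=; lia.
by exists (rcons t x); rewrite cat_rcons.
Qed.

(** The link is a set of points, whose homology is free on them, while that of the
    0-sphere has two generators but is not cyclic. *)
Lemma two_cofaces s : ordered_simplex L s -> size s = n ->
  exists x y, [/\ x != y, ordered_simplex L (x :: s), ordered_simplex L (y :: s) &
    forall z, ordered_simplex L (z :: s) -> z = x \/ z = y].
Proof.
move=> Ls sn; have [|x Lx] := coface Ls; first by rewrite sn.
have E0 : n%:Z - (size s)%:Z = 0%N by rewrite sn; lia.
have [g2 g1] := sphere0_homology0 R.
have {}g2 := (link_homology 2 0 Ls E0).2 g2.
have {}g1 : ~ generated 1 (homology R (lk s) 0).
  by rewrite (link_homology 1 0 Ls E0).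
have B0 b t : boundaries R (lk s) 0 b -> b t = 0.
  move=> [d /chainP[_ _ dS] ->]; case: t => // y t; apply: bd0 => z.
  apply/eqP/negPn/negP => /dS[Kt _].
  have := simplex_size_le ((link_simplexP (t := z :: y :: t) Ls isT).1 Kt).
  by rewrite size_cat /= sn; lia.
have Zv z : ordered_simplex L (z :: s) -> cycles R (lk s) 0 (@vertex_chain R V z).
  by move=> Lz; apply: vertex_chain_cycle; exact/lk_vertex.
have [y [xy Ly]] : exists y, x != y /\ ordered_simplex L (y :: s).
  apply: contrapT => ny; apply: g1; apply/generated1P.
  exists (vertex_chain R x); first exact: Zv.
  move=> c [/chainP[_ _ cK] _]; exists (c [:: x]).
  rewrite (_ : _ - _ = 0); first exact: smem0.
  apply/eqP; rewrite subr_eq0; apply/eqP/funext => t; rewrite !fctE /vertex_chain.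
  case: (t =P _) => [->|tx]; first by rewrite scale1o.
  rewrite scaler0; apply/eqP/negPn/negP => /cK[Kt /(size_dimP _ 0)].
  case: t tx Kt => [//|z [|//]] zx Kt _; apply: ny; exists z.
  split; last exact/(link_simplexP (t := [:: z]) Ls).
  by apply: contra_notN zx => /eqP ->.
exists x, y; split=> // z Lz; apply: contrapT => /not_orP[zx zy].
pose p (i : 'I_(2 + 1)) := nth x [:: x; y; z] i.
apply: (@not_generated _ _ _ _ 2 (fun i => [:: p i])
          (fun j => vertex_chain R (p j))) g2 => [j|b i|i j].
- by apply: Zv; rewrite /p; case: j => -[|[|[|]]].
- exact: B0.
rewrite /vertex_chain eqseq_cons andbT nth_uniq //= !inE negb_or xy.
by rewrite !(eq_sym _ z) /=; apply/and3P; split; apply/eqP.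
Qed.

End Manifold.

(** * Exactness of the chain complexes of stars *)

Definition star_chain (R : comNzRingType) (V : choiceType) (L : complex V)
    (s : seq V) (k : nat) (f : seq V -> R^o) : Prop :=
  altern f /\ forall t, f t != 0 ->
    [/\ ordered_simplex L t, {subset s <= t} & size t = k].

(** An orientation is needed through its values in [R] alone, as a generator of the
    top homology of all stars; in characteristic two the constant 1 is one,
    whether or not the complex is orientable. *)
Definition coeff_orientation (R : comNzRingType) (n : nat) (V : choiceType)
    (L : complex V) (mu : seq V -> R^o) : Prop :=
  [/\ altern mu,
      forall s, mu s != 0 -> ordered_simplex L s /\ size s = n.+1,
      forall s, ordered_simplex L s -> size s = n.+1 -> mu s * mu s = 1 &
      forall t x y, ordered_simplex L t -> size t = n -> x != y ->
        ordered_simplex L (x :: t) -> ordered_simplex L (y :: t) ->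
        mu (x :: t) = - mu (y :: t)].

Lemma perm_star (T : eqType) (s t : seq T) : uniq s -> uniq t ->
  {subset s <= t} -> perm_eq ([seq x <- t | x \notin s] ++ s) t.
Proof.
move=> us ut st; apply: uniq_perm => // [|x].
  rewrite cat_uniq filter_uniq // us andbT; apply/hasPn => x xs.
  by rewrite mem_filter xs.
rewrite mem_cat mem_filter; case: (boolP (x \in s)) => [/st ->|_] //=.
by rewrite orbF.
Qed.

Lemma ordered_simplex_perm (V : choiceType) (L : complex V) s t : perm_eq s t ->
  ordered_simplex L s -> ordered_simplex L t.
Proof.
by move=> st; rewrite /ordered_simplex (perm_uniq st) (fset_seq_perm st).
Qed.

Section Star.
Variables (R : comNzRingType) (V : choiceType) (L : complex V).
Hypothesis Lf : locally_finite L.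
Variable s : seq V.
Hypothesis Ls : ordered_simplex L s.
Implicit Types (f g h : seq V -> R^o) (t : seq V).

Local Notation lk := (link L [fset x in s]%fset).

Lemma star_supp : exists B, forall k f, star_chain L s k f -> supp_in B f.
Proof.
have [B HB] := near_finite [fset x in s]%fset Lf; exists B => k f [_ fS] t x xt xB.
apply/eqP/negPn/negP => /fS[Lt st _]; case/negP: xB.
have [y ys] := ordered_simplex_mem Ls.
by apply: (HB t y) => //; [exact: st | rewrite inE].
Qed.

Lemma star_link k j f : star_chain L s k f -> k = (size s + j.+1)%N ->
  chain lk j%:Z (fun t => f (t ++ s)).
Proof.
move=> fS kE; have [fA f1] := fS; have [B fB] := star_supp.
apply/chainP; split.
- split=> [u x y t|t nt]; first by rewrite -!catA (fA.1 u).
  by apply: fA.2; rewrite cat_uniq (negbTE nt).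
- by exists B => t x xt; apply: fB fS _ _ _; rewrite mem_cat xt.
move=> t /f1[Lts _]; rewrite size_cat kE addnC => /addnI tj.
split; last by rewrite tj; lia.
by apply/link_simplexP => //; case: (t) tj.
Qed.

(** An alternating function is determined by one ordering of each simplex; here
    the vertices of [s] come last. *)
Lemma star_extend k h : altern h ->
  (forall t, h t != 0 -> ordered_simplex L (t ++ s) /\ size (t ++ s) = k) ->
  exists2 f, star_chain L s k f & forall t, f (t ++ s) = h t.
Proof.
move=> hA hS; have [us _] := Ls.
pose tl (C : {fset V}) := [seq x <- enum_fset C | x \notin s].
pose f t : R^o := if all (mem t) s then
  sgn R t * (sgn R (tl [fset x in t]%fset ++ s) * h (tl [fset x in t]%fset)) else 0.
have tlE t : uniq t -> all (mem t) s -> perm_eq (tl [fset x in t]%fset ++ s) t.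
  move=> ut /allP st; have et := perm_enum_fset ut; rewrite perm_sym in et.
  apply: perm_trans et; apply: perm_star => // x /st /= xt.
  by rewrite (perm_mem (perm_enum_fset ut)) in xt.
have fA : altern f.
  have [gN g0] := altern_sgn V R.
  split=> [u x y v|t nt]; last by rewrite /f g0 // mul0r if_same.
  have uv := swap_perm u v x y.
  rewrite /f (fset_seq_perm uv) (eq_all (perm_mem uv)) gN.
  by case: ifP; rewrite ?oppr0 // mulNr.
exists f => [|t].
  split=> // t ft; have ut : uniq t by apply: contraNT ft => /fA.2 ->.
  move: ft; rewrite /f; case: ifP => [st ft|]; last by rewrite eqxx.
  have /hS[Lt <-] : h (tl [fset x in t]%fset) != 0.
    by apply: contraNneq ft => ->; rewrite !mulr0.
  have pt := tlE t ut st; split; last exact/esym/perm_size.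
    exact: ordered_simplex_perm pt Lt.
  exact/allP.
have [ut|nt] := boolP (uniq (t ++ s)); last first.
  rewrite fA.2 //; apply/esym/eqP/negPn/negP => /hS[[ut _] _].
  by rewrite ut in nt.
have st : all (mem (t ++ s)) s by apply/allP => x xs; rewrite /= mem_cat xs orbT.
have := tlE _ ut st; rewrite /f st; move: (tl _) => t'.
rewrite perm_cat2r => tt'.
have sA : altern (fun u => sgn R (u ++ s)).
  split=> [u x y v|u nu]; first by rewrite -!catA ((altern_sgn V R).1 u).
  by apply: (altern_sgn V R).2; rewrite cat_uniq (negbTE nu).
by rewrite (altern_mul sA hA tt') mulrA sgn_sqr // mul1r.
Qed.

Lemma star_eq f g : altern f -> altern g -> (forall t, f (t ++ s) = g (t ++ s)) ->
  forall t, {subset s <= t} -> f t = g t.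
Proof.
move=> fA gA fg t st; have [ut|nt] := boolP (uniq t); last by rewrite fA.2 ?gA.2.
by have [us _] := Ls; apply: altern_eq_perm fA gA (perm_star us ut st) _.
Qed.

Lemma star_bd_eq0 k f : star_chain L s k f ->
  (forall t, ordered_simplex L t -> {subset s <= t} -> bd f t = 0) ->
  forall t, {subset s <= t} -> bd f t = 0.
Proof.
move=> [_ fS] bf t st.
have [//|/bd_neq0[x /fS[Lxt _ _]]] := eqVneq (bd f t) 0.
apply: bf => //; apply: (ordered_simplex_sub Lxt).
- by have [y /st] := ordered_simplex_mem Ls; case: (t).
- by case: Lxt => /= /andP[].
- by move=> y yt; rewrite inE yt orbT.
Qed.

End Star.

Fact mulr_sqr1 (S : comPzRingType) (a b x y : S) :
  b * y * (b * y) = 1 -> a * x = a * (b * y * y) * (b * x).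
Proof. by move=> E; rewrite -[a * x]mulr1 -E; ring. Qed.

Section ManifoldStar.
Variables (R : comNzRingType) (n : nat) (V : choiceType) (L : complex V).
Hypothesis Lmfd : homology_manifold R n L.
Variable s : seq V.
Hypothesis Ls : ordered_simplex L s.

Local Notation Lf := (Lmfd.1).
Local Notation lk := (link L [fset x in s]%fset).

(** In positive degrees this is the vanishing of the homology of the link below
    its dimension. In degree 0 that homology is cyclic, and the augmentation, being
    onto, is injective on it. *)
Lemma link_exact j (g : seq V -> R^o) : (size s + j.+1 <= n)%N ->
  chain lk j%:Z g -> (forall t, bd g t = 0) -> boundaries R lk j%:Z g.
Proof.
move=> jn gc bg; have Zg : cycles R lk j%:Z g.
  by split=> //; apply/funext => -[|x t] //; exact: bg.
have m0 : n%:Z - (size s)%:Z = Posz (n - size s) by lia.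
case: j jn gc Zg => [|j] jn gc Zg; last first.
  apply: (generated0P _ _).1 Zg; apply/(link_homology Lmfd _ _ Ls m0).
  by apply: sphere_homology_mid; lia.
have : generated 1 (homology R lk 0).
  by apply/(link_homology Lmfd _ _ Ls m0); apply: sphere_homology0; lia.
move=> /generated1P[e [ec _] eP]; have [b Bb] := eP _ Zg.
(* The class of a vertex has augmentation 1, which makes that of [e] invertible. *)
have [|x Lx] := coface Lmfd Ls; first by lia.
have [a Ba] := eP _ (vertex_chain_cycle R ((lk_vertex x Ls).2 Lx)).
have bdB c (r : R) : chain lk 0 c -> bd (c - r *: e) [::] = bd c [::] - r * bd e [::].
  move=> /chainP[_ [C cC] _]; have /chainP[_ [D eD] _] := ec.
  have {}cC := supp_in_sub (fsubsetUl C D) cC.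
  have {}eD := supp_in_sub (fsubsetUr C D) eD.
  rewrite (bdE _ cC) (bdE _ eD) (@bdE _ _ (C `|` D)%fset) => [|t y yt yCD].
    by rewrite mulr_sumr -sumrB.
  by rewrite !fctE (cC _ _ yt) // (eD _ _ yt) // scaler0 subr0.
have := boundaries_augmentation Ba; have := boundaries_augmentation Bb.
rewrite !bdB // ?bd_vertex_chain ?bg; last first.
  by have [] := vertex_chain_cycle R ((lk_vertex x Ls).2 Lx).
move=> /eqP; rewrite sub0r oppr_eq0 => /eqP be /eqP; rewrite subr_eq0 => /eqP ae.
have b0 : b = 0 by rewrite -[b]mulr1 ae mulrCA be mulr0.
by rewrite b0 scale0r subr0 in Bb.
Qed.

(** By [link_exact], read on the sequences ending with [s]. In the lowest degree, a
    chain is a multiple of the empty simplex of the link, and this is the boundary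
    of any vertex of the link. *)
Lemma star_exact k (f : seq V -> R^o) : star_chain L s k f -> (k <= n)%N ->
  (forall t, ordered_simplex L t -> {subset s <= t} -> bd f t = 0) ->
  exists2 h, star_chain L s k.+1 h & forall t, {subset s <= t} -> bd h t = f t.
Proof.
move=> fS kn bf; have [fA f1] := fS.
have {}bf := star_bd_eq0 Ls fS bf.
have bg t : bd (fun t => f (t ++ s)) t = 0.
  by rewrite -[LHS]/(bd f (t ++ s)); apply: bf => x xs; rewrite mem_cat xs orbT.
have [ks|sk] := ltnP k (size s).
  exists 0; first by split=> [|t]; [split=> // *; rewrite oppr0 | rewrite eqxx].
  move=> t st; rewrite bd0 //; apply/esym/eqP/negPn/negP => /f1[[ut _] _ tk].
  by have [us _] := Ls; have := uniq_leq_size us st; rewrite tk leqNgt ks.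
suff [h [hA hS hb]] : exists h : seq V -> R^o, [/\ altern h,
    forall t, h t != 0 -> ordered_simplex L (t ++ s) /\ size (t ++ s) = k.+1 &
    forall t, bd h t = f (t ++ s)].
  have [H HS HE] := star_extend Ls hA hS; exists H => //.
  have [B HB] := star_supp R Lf Ls.
  apply: (star_eq Ls (altern_bd (HB _ _ HS) HS.1) fA) => t.
  rewrite -hb; apply: eq_fsbigr => x _; exact: (HE (x :: t)).
case: (posnP (k - size s)) => [k0|].
  have {k0}sk : size s = k by lia.
  have [|x Lx] := coface Lmfd Ls; first by rewrite sk.
  have [/chainP[vA [C vC] vS] _] := vertex_chain_cycle R ((lk_vertex x Ls).2 Lx).
  exists (fun t => f s * vertex_chain R x t); split.
  - exact: altern_scale.
  - move=> t; rewrite /vertex_chain; case: (t =P _) => [-> _|]; last by rewrite mulr0 eqxx.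
    by rewrite /= sk.
  move=> t.
  rewrite (@bd_one _ _ _ _ x) => [|z zx]; last first.
    by rewrite /vertex_chain eqseq_cons (negbTE zx) mulr0.
  rewrite /vertex_chain eqseq_cons eqxx /=; case: t => [|y t]; first by rewrite mulr1.
  rewrite mulr0; apply/esym/eqP/negPn/negP => /f1[_ _].
  by rewrite -sk size_cat /=; lia.
case kE : (k - size s)%N => [//|j] _; have {kE}kE : k = (size s + j.+1)%N by lia.
have gc := star_link Lf Ls fS kE.
have [|d dc dE] := link_exact _ gc bg; first by rewrite -kE.
have /chainP[dA [C dC] dS] := dc; exists d; split=> // [t /dS[Kt td]|t].
  have tj : size t = j.+2 by lia.
  rewrite size_cat tj kE; split; last by lia.
  by apply/link_simplexP => //; case: (t) tj.
by rewrite -(boundary_bd _ dc) -?dE //; lia.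
Qed.

(** The link has the top homology of a sphere, and no boundaries in that degree.
    Over simplices of dimension [n] and [n - 1] the cycles of the link are in
    degree -1 and in reduced degree 0, and are found directly. *)
Lemma star_top_cyclic : exists e : seq V -> R, forall f, star_chain L s n.+1 f ->
  (forall t, {subset s <= t} -> bd f t = 0) ->
  exists a, forall t, f (t ++ s) = a * e t.
Proof.
have [ns|sn] := ltnP n (size s).
  have {}ns : size s = n.+1 by have := simplex_size_le Lmfd Ls; lia.
  exists (fun t => (t == [::])%:R) => f [_ fS] _; exists (f s) => -[|x t].
    by rewrite mulr1.
  rewrite mulr0; apply/eqP/negPn/negP => /fS[_ _].
  by rewrite size_cat ns /=; lia.
have [E|sn'] := eqVneq (size s) n.
  have [x [y [xy Lx Ly xyP]]] := two_cofaces Lmfd Ls E.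
  exists (fun t => vertex_chain R x t - vertex_chain R y t) => f [_ fS] bf.
  have f0 z : z != x -> z != y -> f (z :: s) = 0.
    move=> zx zy; apply/eqP/negPn/negP => /fS[/xyP[]/eqP]; first by rewrite (negbTE zx).
    by rewrite (negbTE zy).
  have := bf s (fun x xs => xs); rewrite (bd_two xy f0) => /eqP.
  rewrite addrC addr_eq0 => /eqP fy.
  exists (f (x :: s)) => t; rewrite /vertex_chain.
  case: (t =P [:: x]) => [->|tx].
    by rewrite eqseq_cons (negbTE xy) subr0 mulr1.
  case: (t =P [:: y]) => [->|ty]; first by rewrite sub0r mulrN mulr1.
  rewrite subr0 mulr0; apply/eqP/negPn/negP => ft.
  have [_ _] := fS _ ft; rewrite size_cat E => tn.
  case: t tx ty ft tn => [|z [|w t]] /= tx ty ft tn; [lia| |lia].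
  by case/eqP: ft; apply: f0; [apply: contra_notN tx | apply: contra_notN ty] => /eqP ->.
have m0 : n%:Z - (size s)%:Z = Posz (n - size s) by lia.
have : generated 1 (homology R lk (n - size s)%N%:Z).
  by apply/(link_homology Lmfd _ _ Ls m0); apply: sphere_homology_top; lia.
move=> /generated1P[e _ eP]; exists e => f fS bf.
have gc := star_link Lf Ls fS (j := (n - size s)%N).
have {}gc : chain lk (n - size s)%N (fun t => f (t ++ s)) by apply: gc; lia.
have [|a [d /chainP[_ _ dS] dE]] := eP (fun t => f (t ++ s)).
  split=> //; apply/funext => -[|x t] //.
  by rewrite -[LHS]/(bd f ((x :: t) ++ s)); apply: bf => y ys; rewrite mem_cat ys orbT.
exists a => t; apply/eqP; rewrite -subr_eq0.
rewrite -[X in X == _]/(((fun t => f (t ++ s)) - a *: e) t) dE.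
case: t => // x t; apply/eqP/bd0 => y; apply/eqP/negPn/negP => /dS[Kt td].
have := simplex_size_le Lmfd ((link_simplexP (t := y :: x :: t) Ls isT).1 Kt).
by rewrite size_cat; move: td => /=; lia.
Qed.

Definition to_star (mu : seq V -> R^o) t : R^o := if all (mem t) s then mu t else 0.

Lemma to_star_chain mu : coeff_orientation n L mu -> star_chain L s n.+1 (to_star mu).
Proof.
move=> [muA muS _ _]; split; last first.
  move=> t; rewrite /to_star; case: ifP => [/allP st /muS[Lt tn]|]; last by rewrite eqxx.
  by split.
split=> [u x y v|t nt]; last by rewrite /to_star muA.2 // if_same.
have uv := swap_perm u v x y.
by rewrite /to_star (eq_all (perm_mem uv)) muA.1; case: ifP; rewrite ?oppr0.
Qed.

Lemma to_star_cycle mu t : coeff_orientation n L mu -> ordered_simplex L t ->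
  {subset s <= t} -> bd (to_star mu) t = 0.
Proof.
move=> mu_or Lt st; have musS := to_star_chain mu_or; have [_ _ _ muN] := mu_or.
have subt z : all (mem (z :: t)) s by apply/allP => x /st xt; rewrite /= inE xt orbT.
have [tn|tn] := eqVneq (size t) n; last first.
  apply: bd0 => x; apply/eqP/negPn/negP => /musS.2[_ _ /= [tE]].
  by rewrite tE eqxx in tn.
have [x [y [xy Lx Ly xyP]]] := two_cofaces Lmfd Lt tn.
rewrite (bd_two xy) => [|z zx zy]; last first.
  apply/eqP/negPn/negP => /musS.2[/xyP[]/eqP]; first by rewrite (negbTE zx).
  by rewrite (negbTE zy).
by rewrite /to_star !subt (muN t x y) // addNr.
Qed.

(** An orientation generates the top cycles because it takes invertible values:
    its coefficient on the generator must then be invertible. *)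
Lemma star_top mu f : coeff_orientation n L mu -> star_chain L s n.+1 f ->
  (forall t, ordered_simplex L t -> {subset s <= t} -> bd f t = 0) ->
  exists a : R, forall t, {subset s <= t} -> f t = a * mu t.
Proof.
move=> mu_or fS bf; have [us _] := Ls; have [muA _ mu1 _] := mu_or.
have {}bf := star_bd_eq0 Ls fS bf.
have [e eP] := star_top_cyclic.
have [|b bE] := eP _ (to_star_chain mu_or).
  by apply: (star_bd_eq0 Ls (to_star_chain mu_or)) => t; exact: to_star_cycle.
have [a aE] := eP _ fS bf.
have [t0 [Lt0 t0n]] := purity Lmfd Ls.
have muE t : mu (t ++ s) = b * e t.
  have st : all (mem (t ++ s)) s by apply/allP => x xs; rewrite /= mem_cat xs orbT.
  by rewrite -bE /to_star st.
exists (a * (mu (t0 ++ s) * e t0)); apply: (star_eq Ls) => [||t].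
- exact: fS.1.
- exact: altern_scale.
rewrite aE (muE t) (muE t0); apply: mulr_sqr1.
by rewrite -muE; exact: mu1.
Qed.

End ManifoldStar.

(** * The double complex of incident pairs of simplices *)

Section Bicomplex.
Variables (R : comNzRingType) (V : choiceType) (L : complex V).
Implicit Types (s t u v : seq V) (F G H : seq V -> seq V -> R^o) (m : int).

Definition incident s t : Prop :=
  [/\ ordered_simplex L s, ordered_simplex L t & {subset s <= t}].

Definition bichain m F : Prop :=
  [/\ forall t, altern (F^~ t), forall s, altern (F s),
      exists B, forall s, supp_in B (F s) &
      forall s t, F s t != 0 -> incident s t /\ (size t)%:Z - (size s)%:Z = m].

(** The sign makes the two commuting differentials anticommute. *)
Definition total_diff F s t : R^o :=
  if `[< incident s t >]
  then cobd predT (F^~ t) s + (-1) ^+ size s *: bd (F s) t else 0.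

Lemma incident_perml s s' t : perm_eq s s' -> incident s t -> incident s' t.
Proof.
move=> ss' [Ls Lt st]; split=> //; first exact: ordered_simplex_perm Ls.
by move=> x; rewrite -(perm_mem ss'); exact: st.
Qed.

Lemma incident_permr s t t' : perm_eq t t' -> incident s t -> incident s t'.
Proof.
move=> tt' [Ls Lt st]; split=> //; first exact: ordered_simplex_perm Lt.
by move=> x /st; rewrite (perm_mem tt').
Qed.

Lemma incident_face u x v t : u ++ v != [::] ->
  incident (u ++ x :: v) t -> incident (u ++ v) t.
Proof.
move=> uv0 [Ls Lt st].
have sub : {subset u ++ v <= u ++ x :: v}.
  by move=> y; rewrite !mem_cat inE => /orP[] ->; rewrite ?orbT.
split=> //; last by move=> y /sub/st.
apply: (ordered_simplex_sub Ls) => //; have [us _] := Ls.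
by move: us; rewrite !cat_uniq /= negb_or => /and3P[-> /andP[_ ->] /andP[_ ->]].
Qed.

Section Fixed.
Variables (m : int) (F : seq V -> seq V -> R^o).
Hypothesis Fm : bichain m F.

Lemma bichain_eq0 s t : ~ incident s t -> F s t = 0.
Proof. by have [_ _ _ FS] := Fm; move=> st; apply/eqP/negPn/negP => /FS[]. Qed.

Lemma bichain_nil t : F [::] t = 0.
Proof. by apply: bichain_eq0 => -[/ordered_simplex_neq0]. Qed.

(** Where the definition of [total_diff] puts 0 for lack of incidence, its formula
    vanishes at the faces of a simplex, and at the cofaces of a simplex. *)
Lemma total_face u x v t : incident (u ++ x :: v) t ->
  total_diff F (u ++ v) t =
  cobd predT (F^~ t) (u ++ v) + (-1) ^+ size (u ++ v) *: bd (F (u ++ v)) t.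
Proof.
rewrite /total_diff; have [->|uv0] := eqVneq (u ++ v) [::].
  move=> _; rewrite asboolF; last by case=> /ordered_simplex_neq0.
  by rewrite /= add0r bd0 ?scaler0 // => y; rewrite bichain_nil.
by move=> /(incident_face uv0) I; rewrite asboolT.
Qed.

Lemma total_coface s x t : incident s t ->
  total_diff F s (x :: t) =
  cobd predT (F^~ (x :: t)) s + (-1) ^+ size s *: bd (F s) (x :: t).
Proof.
move=> [Ls Lt st]; rewrite /total_diff; case: asboolP => // nI.
have nL : ~ ordered_simplex L (x :: t).
  by move=> Lxt; apply: nI; split=> // y ys; rewrite inE st ?orbT.
rewrite bd0 => [|y]; last first.
  apply: bichain_eq0 => -[_ Lyxt _]; apply: nL; apply: (ordered_simplex_sub Lyxt) => //.
    by case: Lyxt => /= /andP[].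
  by move=> z zt; rewrite inE zt orbT.
rewrite scaler0 addr0 cobd0 // => u y v _.
by apply: bichain_eq0 => -[_ /nL].
Qed.

Lemma altern_bd_l t : altern (fun s => bd (F s) t).
Proof.
have [Fl _ [B FB] _] := Fm; split=> [s x y u|s ns]; last first.
  by apply: bd0 => x; apply: (Fl _).2.
rewrite !(bdE _ (FB _)) -sumrN; apply: eq_bigr => z _; exact: (Fl _).1.
Qed.

Lemma altern_cobd_r s : altern (fun t => cobd predT (F^~ t) s).
Proof.
have [_ Fr _ _] := Fm; split=> [t x y u|t nt]; last first.
  by apply: cobd0 => *; apply: (Fr _).2.
by rewrite -cobdN; apply: cobd_ext => v z w _; exact: (Fr _).1.
Qed.

Lemma total_bichain : bichain (m - 1) (total_diff F).
Proof.
have [Fl Fr [B FB] FS] := Fm; split.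
- move=> t; split=> [s x y u|s ns]; last first.
    by rewrite /total_diff asboolF // => -[[us _] _ _]; rewrite us in ns.
  rewrite /total_diff; case: asboolP => I.
    rewrite asboolT; last exact: incident_perml (swap_perm _ _ _ _) I.
    rewrite (altern_cobd predT (Fl t)).1 (altern_bd_l t).1 scalerN -opprD.
    by rewrite !size_cat.
  rewrite asboolF ?oppr0 // => J; apply: I.
  exact: incident_perml (swap_perm _ _ _ _) J.
- move=> s; split=> [t x y u|t nt]; last first.
    by rewrite /total_diff asboolF // => -[_ [ut _] _]; rewrite ut in nt.
  rewrite /total_diff; case: asboolP => I.
    rewrite asboolT; last exact: incident_permr (swap_perm _ _ _ _) I.
    by rewrite (altern_cobd_r s).1 (altern_bd (FB s) (Fr s)).1 scalerN -opprD.
  rewrite asboolF ?oppr0 // => J; apply: I.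
  exact: incident_permr (swap_perm _ _ _ _) J.
- exists B => s t x xt xB; rewrite /total_diff; case: asboolP => // _.
  rewrite cobd0 => [|u y v _]; last exact: FB xt xB.
  by rewrite add0r (supp_in_bd (FB s) xt xB) scaler0.
move=> s t; rewrite /total_diff; case: asboolP => [I DF|]; last by rewrite eqxx.
split=> //; apply: contrapT => st; case/negP: DF; apply/eqP.
rewrite cobd0 => [|u x v sE].
  rewrite add0r bd0 ?scaler0 // => x; apply/eqP/negPn/negP => /FS[_ /= E].
  by apply: st; lia.
apply/eqP/negPn/negP => /FS[_ E]; apply: st; move: E.
by rewrite sE !size_cat /=; lia.
Qed.

Lemma total_diff_diff : total_diff (total_diff F) = 0.
Proof.
have [Fl Fr [B FB] FS] := Fm; apply/funext => s; apply/funext => t.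
rewrite {1}/total_diff; case: asboolP => // I.
rewrite (cobd_ext predT (g := fun u => cobd predT (F^~ t) u +
    (-1) ^+ (size s).-1 *: bd (F u) t)) => [|u x v sE]; last first.
  by rewrite (@total_face u x) -?sE // sE !size_cat addnS.
rewrite (bd_ext (g := fun u => cobd predT (F^~ u) s + (-1) ^+ size s *: bd (F s) u));
  last by move=> x; rewrite total_coface.
rewrite cobdD cobd_cobd add0r.
have -> : bd (fun u => cobd predT (F^~ u) s + (-1) ^+ size s *: bd (F s) u) t =
    cobd predT (fun u => bd (F u) t) s.
  rewrite -(bd_cobd2 predT s t FB) (@bdE _ _ B) => [|u x xu xB]; last first.
    rewrite cobd0 => [|*]; last exact: FB xu xB.
    by rewrite add0r (supp_in_bd (FB s) xu xB) scaler0.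
  rewrite big_split /= -scaler_sumr -(bdE _ (supp_in_bd (FB s))).
  rewrite (bd_bd _ (FB s) (Fr s)) scaler0 addr0 (@bdE _ _ B) // => u x xu xB.
  by rewrite cobd0 // => *; apply: FB xu xB.
rewrite cobdZ.
case: s I => [|x s] I; first by have [/ordered_simplex_neq0] := I.
by rewrite /= exprS mulN1r scaleNr subrr.
Qed.

End Fixed.

Lemma bichain0 m : bichain m 0.
Proof.
split; try by move=> t; split=> // *; apply/esym/(@oppr0 R^o).
  by exists fset0 => s t x.
by move=> s t; rewrite eqxx.
Qed.

Lemma bichain_lin m a F G : bichain m F -> bichain m G -> bichain m (a *: F + G).
Proof.
move=> [Fl Fr [B FB] FS] [Gl Gr [C GC] GS]; split.
- move=> t; split=> [s x y u|s ns]; rewrite !fctE.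
    by rewrite (Fl t).1 (Gl t).1 scalerN opprD.
  by rewrite (Fl t).2 // (Gl t).2 // scaler0 addr0.
- move=> s; split=> [t x y u|t nt]; rewrite !fctE.
    by rewrite (Fr s).1 (Gr s).1 scalerN opprD.
  by rewrite (Fr s).2 // (Gr s).2 // scaler0 addr0.
- exists (B `|` C)%fset => s t x xt; rewrite inE negb_or => /andP[xB xC].
  by rewrite !fctE (FB _ _ _ xt) // (GC _ _ _ xt) // scaler0 addr0.
move=> s t; rewrite !fctE; have [->|/FS //] := eqVneq (F s t) 0.
by rewrite scaler0 add0r => /GS.
Qed.

Lemma total_diff_lin m m' a F G : bichain m F -> bichain m' G ->
  total_diff (a *: F + G) = a *: total_diff F + total_diff G.
Proof.
move=> [_ _ [B FB] _] [_ _ [C GC] _]; apply/funext => s; apply/funext => t.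
rewrite !fctE /total_diff; case: asboolP => _; last by rewrite scaler0 addr0.
have -> : cobd predT ((a *: F + G)^~ t) s =
    a *: cobd predT (F^~ t) s + cobd predT (G^~ t) s.
  rewrite -[LHS]/(cobd predT (fun u => a *: F u t + G u t) s) cobdD.
  by rewrite cobdZ.
have -> : bd ((a *: F + G) s) t = a *: bd (F s) t + bd (G s) t.
  have {}FB := supp_in_sub (fsubsetUl B C) (FB s).
  have {}GC := supp_in_sub (fsubsetUr B C) (GC s).
  rewrite (bdE _ FB) (bdE _ GC) (@bdE _ _ (B `|` C)%fset) => [|u x xu xB].
    by rewrite scaler_sumr -big_split.
  by rewrite !fctE (FB _ _ xu) // (GC _ _ xu) // scaler0 addr0.
rewrite !scalerDr addrACA; congr (_ + (_ + _)).
by rewrite !scalerA mulrC.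
Qed.

Lemma total_diffD m m' F G : bichain m F -> bichain m' G ->
  total_diff (F + G) = total_diff F + total_diff G.
Proof. by move=> Fm Gm; rewrite -[F]scale1r (total_diff_lin 1 Fm Gm) !scale1r. Qed.

Lemma total_diffB m m' F G : bichain m F -> bichain m' G ->
  total_diff (F - G) = total_diff F - total_diff G.
Proof.
move=> Fm Gm; rewrite addrC -scaleN1r (total_diff_lin _ Gm Fm) scaleN1r.
by rewrite addrC.
Qed.

Lemma bichainB m F G : bichain m F -> bichain m G -> bichain m (F - G).
Proof. by move=> Fm Gm; rewrite addrC -scaleN1r; exact: bichain_lin. Qed.

Lemma total_diff0 : total_diff 0 = 0.
Proof.
by have := total_diffB (bichain0 0) (bichain0 0); rewrite !subrr.
Qed.

End Bicomplex.

(** * Chains in the double complex *)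

Section FromChains.
Variables (R : comNzRingType) (V : choiceType) (L : complex V).
Implicit Types (s t u v : seq V) (F G H : seq V -> seq V -> R^o) (m : int).
Implicit Types (c : seq V -> R^o).

Definition from_chain c s t : R^o :=
  if s is [:: x] then (if x \in t then c t else 0) else 0.

Lemma from_chain_bichain m c : chain L m c -> bichain L m (from_chain c).
Proof.
move=> /chainP[cA [B cB] cS]; split.
- move=> t; split=> [s x y u|s ns]; last by case: s ns => // x [].
  by case: s => [|z [|w s]]; rewrite /= oppr0.
- move=> [|v [|w s]]; try by split=> *; rewrite /= ?oppr0.
  split=> [t x y u|t nt] /=; last by rewrite cA.2 // if_same.
  by rewrite (perm_mem (swap_perm _ _ _ _)) cA.1; case: ifP; rewrite ?oppr0.
- exists B => -[|v [|w s]] // t x xt xB /=.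
  by rewrite (cB _ _ xt xB) if_same.
move=> [|v [|w s]] t /=; rewrite ?eqxx //.
case: ifP => [vt /cS[Lt tm]|]; rewrite ?eqxx //; split=> //.
have sub : {subset [:: v] <= t} by move=> x; rewrite inE => /eqP ->.
by split=> //; apply: (ordered_simplex_sub Lt).
Qed.

Lemma from_chain_lin a c d :
  from_chain (a *: c + d) = a *: from_chain c + from_chain d.
Proof.
apply/funext => -[|v [|w s]]; apply/funext => t; rewrite !fctE /= ?scaler0 ?addr0 //.
by case: ifP; rewrite ?scaler0 ?addr0.
Qed.

Lemma from_chain_inj c : c [::] = 0 -> from_chain c = 0 -> c = 0.
Proof.
move=> c0 Ec; apply/funext => -[|x t] //.
by have := congr1 (fun F => F [:: x] (x :: t)) Ec; rewrite /= inE eqxx.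
Qed.

Lemma total_from_chain m c : chain L m c ->
  total_diff L (from_chain c) = - from_chain (boundary c).
Proof.
move=> cc; have /chainP[cA [B cB] cS] := cc.
apply/funext => s; apply/funext => t; rewrite !fctE /total_diff.
case: asboolP => [[Ls Lt st]|nI]; last first.
  case: s nI => [|v [|w s]] nI /=; rewrite ?oppr0 //.
  case: ifP => vt; rewrite ?oppr0 //; case: t vt nI => // y t vt nI.
  rewrite [boundary _ _]bd0 ?oppr0 // => x; apply/eqP/negPn/negP => /cS[Lxt _].
  apply: nI; have Lt : ordered_simplex L (y :: t).
    apply: (ordered_simplex_sub Lxt) => //; first by case: Lxt => /= /andP[].
    by move=> z zt; rewrite inE zt orbT.
  have sub : {subset [:: v] <= y :: t} by move=> z; rewrite inE => /eqP ->.
  by split=> //; apply: (ordered_simplex_sub Lt).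
case: s Ls st => [/ordered_simplex_neq0 //|v [|w s]] Ls st.
  have vt : v \in t by rewrite st ?inE.
  rewrite /= vt subr0 add0r expr1 scaleN1r; congr (- _).
  case: t Lt st vt => [//|y t] _ _ vt; apply: bd_ext => x.
  by rewrite /= in_cons vt orbT.
rewrite /= [bd _ _]bd0 // scaler0 addr0 oppr0.
case: s Ls st => [|z s] Ls st.
  by rewrite /= !st ?inE ?eqxx ?orbT // !mulr1n subr0 subrr.
by rewrite cobd0 // !mul0rn !subr0.
Qed.

(** A simplex has the cohomology of a point, by coning off a vertex of it; the
    choice of the vertex need only depend on the underlying set. *)
Definition first_vertex t : seq V := take 1 (enum_fset [fset x in t]%fset).

Lemma first_vertexP t : ordered_simplex L t ->
  exists2 x, x \in t & first_vertex t = [:: x].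
Proof.
move=> Lt; have [ut _] := Lt; have st := perm_enum_fset ut.
rewrite /first_vertex; have := ordered_simplex_neq0 Lt.
case: (enum_fset _) st => [|x e] st t0; first by move/perm_size/size0nil: st t0 => ->.
exists x; last by rewrite /= take0.
by rewrite (perm_mem st) inE eqxx.
Qed.

Lemma first_vertex_perm t t' : perm_eq t t' -> first_vertex t = first_vertex t'.
Proof. by move=> tt'; rewrite /first_vertex (fset_seq_perm tt'). Qed.

(** The contraction is applied to a single layer, so that its total boundary does
    not reach layers further up, and never at the empty sequence, where there is
    no simplex. *)
Definition contract k F s t : R^o :=
  if size s == k.+1 then F (first_vertex t ++ s) t else 0.

Lemma contract_bichain m k F : bichain L m F -> bichain L (m + 1) (contract k F).
Proof.
move=> Fm; have [Fl Fr [B FB] FS] := Fm; split.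
- move=> t; split=> [s x y u|s ns]; rewrite /contract.
    by rewrite !size_cat /= catA (Fl t).1 -catA; case: ifP; rewrite ?oppr0.
  by rewrite (Fl t).2 ?if_same // cat_uniq (negbTE ns) !andbF.
- move=> s; split=> [t x y u|t nt]; rewrite /contract; last by rewrite (Fr _).2 ?if_same.
  by rewrite (first_vertex_perm (swap_perm _ _ _ _)) (Fr _).1; case: ifP; rewrite ?oppr0.
- by exists B => s t x xt xB; rewrite /contract (FB _ _ _ xt xB) if_same.
move=> s t; rewrite /contract.
case: (size s =P _) => [sk /FS[[Ls Lt st] tm]|]; last by rewrite eqxx.
have [x xt xE] := first_vertexP Lt; rewrite xE in Ls st tm.
split; last by move: tm => /=; lia.
split=> // [|y ys]; last by apply: st; rewrite mem_cat ys orbT.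
apply: (ordered_simplex_sub Ls); first by case: (s) sk.
  by case: Ls => /= /andP[].
by move=> y ys; rewrite mem_cat ys orbT.
Qed.

(** In the top degree [k.+2] the total boundary of [contract k F] is its
    coboundary, and the defining recursion of [cobd] makes it equal to [F] minus
    the coboundary of [F], which is 0. *)
Lemma total_contract m k F s t : bichain L m F ->
  (forall s t, (1 < size s)%N -> total_diff L F s t = 0) ->
  (forall s t, (k.+2 < size s)%N -> F s t = 0) ->
  (k.+1 < size s)%N -> total_diff L (contract k F) s t = F s t.
Proof.
move=> Fm DF Fk ks; have [Fl _ _ _] := Fm.
rewrite /total_diff; case: asboolP => [I|nI]; last by rewrite (bichain_eq0 Fm).
have [_ Lt st] := I.
have c0 u : (k.+1 < size u)%N -> contract k F u =1 fun=> 0.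
  by move=> ku v; rewrite /contract; case: eqP ku => // ->; rewrite ltnn.
rewrite bd0 => [|x]; last exact: c0.
rewrite scaler0 addr0.
have [ks2|ks2] := ltnP k.+2 (size s).
  rewrite Fk // cobd0 // => u x v sE; apply: c0.
  by move: ks2; rewrite sE !size_cat /= addnS ltnS.
have sk : size s = k.+2 by apply/eqP; rewrite eqn_leq ks2.
have [y yt yE] := first_vertexP Lt.
rewrite (cobd_ext predT (g := fun u => F (y :: u) t)) => [|u x v sE]; last first.
  rewrite /contract yE ifT //; apply/eqP.
  by move: sk; rewrite sE !size_cat /= addnS => -[].
suff : cobd predT (F^~ t) (y :: s) = 0 by move=> /eqP; rewrite subr_eq0 mulr1n => /eqP.
have [us|ns] := boolP (uniq (y :: s)); last by rewrite (altern_cobd _ (Fl t)).2.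
have [Iy|nI] := EM (incident L (y :: s) t).
  have := DF (y :: s) t; rewrite /= sk => /(_ isT).
  rewrite /total_diff asboolT // bd0 ?scaler0 ?addr0 //.
  by move=> x; apply: Fk; rewrite /= sk.
case: nI; split=> //; last by move=> x; rewrite inE => /orP[/eqP ->|/st].
apply: (ordered_simplex_sub Lt) => // x.
by rewrite inE => /orP[/eqP ->|/st].
Qed.

(** A 0-cocycle of a simplex is constant, so that its value can be taken at the
    first vertex. *)
Lemma bichain_from_chain m F : bichain L m F ->
  (forall s t, (1 < size s)%N -> total_diff L F s t = 0) ->
  (forall s t, (1 < size s)%N -> F s t = 0) ->
  exists2 c, chain L m c & F = from_chain c.
Proof.
move=> Fm DF F1; have [Fl Fr [B FB] FS] := Fm.
exists (fun t => F (first_vertex t) t).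
  apply/chainP; split.
  - split=> [t x y u|t nt]; last by rewrite (Fr _).2.
    by rewrite (first_vertex_perm (swap_perm _ _ _ _)) (Fr _).1.
  - by exists B => t x; exact: FB.
  move=> t /FS[[_ Lt _]]; have [x _ ->] := first_vertexP Lt.
  by move=> tm; split.
apply/funext => s; apply/funext => t; rewrite /from_chain.
case: s => [|x [|y s]]; [exact: (bichain_nil Fm) | | exact: F1].
case: ifP => xt; last first.
  by apply: (bichain_eq0 Fm) => -[_ _ /(_ x)]; rewrite inE eqxx xt => /(_ isT).
have [Lt|nt] := EM (ordered_simplex L t); last first.
  by rewrite !(bichain_eq0 Fm) // => -[].
have [y yt ->] := first_vertexP Lt; have [->//|xy] := eqVneq y x.
have := DF [:: y; x] t isT; rewrite /total_diff asboolT; last first.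
  have sub : {subset [:: y; x] <= t} by move=> z; rewrite !inE => /orP[] /eqP ->.
  split=> //; apply: (ordered_simplex_sub Lt) => //.
  by rewrite /= inE xy.
rewrite bd0 => [|z]; last exact: F1.
by rewrite scaler0 addr0 /= subr0 !mulr1n => /eqP; rewrite subr_eq0 => /eqP.
Qed.

(** The layers with more than one vertex in [s] are removed one at a time, from the
    top, by total boundaries. Only the vanishing of [total_diff L F] there is
    assumed: this covers cycles as well as cochains whose total boundary comes
    from a chain. *)
Lemma reduce_to_chain m N F : bichain L m F ->
  (forall s t, (1 < size s)%N -> total_diff L F s t = 0) ->
  (forall s t, (N.+1 < size s)%N -> F s t = 0) ->
  exists2 c, chain L m c &
    exists2 H, bichain L (m + 1) H & F = from_chain c + total_diff L H.
Proof.
elim: N F => [|N IH] F Fm DF FN.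
  have [c cc ->] := bichain_from_chain Fm DF FN; exists c => //.
  exists 0; first exact: bichain0.
  by rewrite total_diff0 addr0.
pose H := contract N F; have Hm : bichain L (m + 1) H by exact: contract_bichain.
have DHm := total_bichain Hm; rewrite addrK in DHm.
have GE : F - total_diff L H = (-1) *: total_diff L H + F by rewrite scaleN1r addrC.
have [|||c cc [K Km KE]] := IH (F - total_diff L H).
- by rewrite GE; exact: bichain_lin.
- move=> s t st; rewrite GE (total_diff_lin _ DHm Fm) (total_diff_diff Hm) scaler0 add0r.
  exact: DF.
- by move=> s t st; rewrite !fctE (total_contract _ Fm DF FN st) subrr.
exists c => //; exists (1 *: K + H); first exact: bichain_lin.
by rewrite (total_diff_lin _ Km Hm) scale1r addrA -KE subrK.
Qed.

End FromChains.

(** * Compactly supported cochains in the double complex *)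

Section FromCochains.
Variables (R : comNzRingType) (n : nat) (V : choiceType) (L : complex V).
Hypothesis Lmfd : homology_manifold R n L.
Variable mu : seq V -> R^o.
Hypothesis mu_orient : coeff_orientation n L mu.
Implicit Types (s t u v : seq V) (F G H : seq V -> seq V -> R^o) (m : int).
Implicit Types (f : seq V -> R^o).

Definition from_cochain f s t : R^o :=
  if `[< incident L s t >] then f s * mu t else 0.

(** Finite chains and compactly supported cochains are the same functions. Local
    finiteness bounds the simplices [t] incident to the support of [f]. *)
Lemma from_cochain_bichain i f : chain L i f -> bichain L (n%:Z - i) (from_cochain f).
Proof.
move=> /chainP[fA [B fB] fS]; have [muA muS _ _] := mu_orient; split.
- move=> t; split=> [s x y u|s ns]; last first.
    by rewrite /from_cochain asboolF // => -[[us _] _ _]; rewrite us in ns.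
  rewrite /from_cochain fA.1; case: asboolP => I.
    rewrite asboolT; last exact: incident_perml (swap_perm _ _ _ _) I.
    exact: mulNr.
  rewrite asboolF ?oppr0 // => J; apply: I.
  exact: incident_perml (swap_perm _ _ _ _) J.
- move=> s; split=> [t x y u|t nt]; last first.
    by rewrite /from_cochain asboolF // => -[_ [ut _] _]; rewrite ut in nt.
  rewrite /from_cochain muA.1; case: asboolP => I.
    rewrite asboolT; last exact: incident_permr (swap_perm _ _ _ _) I.
    exact: mulrN.
  rewrite asboolF ?oppr0 // => J; apply: I.
  exact: incident_permr (swap_perm _ _ _ _) J.
- have [C HC] := near_finite B Lmfd.1; exists C => s t x xt xC.
  rewrite /from_cochain; case: asboolP => // -[Ls Lt st].
  have [y ys] := ordered_simplex_mem Ls.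
  rewrite (fB _ _ ys) ?mul0r //; apply: contra xC => yB.
  by apply: (HC t y) => //; exact: st.
move=> s t; rewrite /from_cochain; case: asboolP => [I ft|]; last by rewrite eqxx.
split=> //; have [|_ sE] := fS s; first by apply: contraNneq ft => ->; rewrite mul0r.
have [|_ ->] := muS t; first by apply: contraNneq ft => ->; rewrite mulr0.
by rewrite -sE; lia.
Qed.

Lemma from_cochain_lin a f g :
  from_cochain (a *: f + g) = a *: from_cochain f + from_cochain g.
Proof.
apply/funext => s; apply/funext => t; rewrite !fctE /from_cochain.
case: asboolP => _; last by rewrite scaler0 addr0.
by rewrite mulrDl; congr (_ + _); exact: esym (mulrA _ _ _).
Qed.

Lemma from_cochain_inj f : (forall s, f s != 0 -> ordered_simplex L s) ->
  from_cochain f = 0 -> f = 0.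
Proof.
move=> fS f0; apply/funext => s; apply/eqP/negPn/negP => fs.
have Ls := fS _ fs; have [t [Lt tn]] := purity Lmfd Ls.
have := congr1 (fun F => F s (t ++ s)) f0.
rewrite /from_cochain asboolT => [E|]; last first.
  by split=> // x xs; rewrite mem_cat xs orbT.
have [_ _ mu1 _] := mu_orient; case/negP: fs; apply/eqP.
rewrite -[f s]mulr1 -(mu1 _ Lt tn) mulrA [X in X * _]E; exact: mul0r.
Qed.

(** The boundary in [t] vanishes since the two [n]-simplices at an [n - 1]-simplex
    have opposite values of [mu]. *)
Lemma total_from_cochain i f : chain L i f ->
  total_diff L (from_cochain f) = from_cochain (coboundary L f).
Proof.
move=> fc; have /chainP[_ _ fS] := fc; have [muA muS mu1 muN] := mu_orient.
have Fm := from_cochain_bichain fc.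
apply/funext => s; apply/funext => t; rewrite /total_diff [RHS]/from_cochain.
case: asboolP => // I; have [Ls Lt st] := I.
have -> : bd (from_cochain f s) t = 0.
  have [tn|tn] := eqVneq (size t) n; last first.
    apply: bd0 => x; rewrite /from_cochain; case: asboolP => // _.
    have -> : mu (x :: t) = 0; last exact: mulr0.
    by apply/eqP/negPn/negP => /muS[_ /= [tE]]; rewrite tE eqxx in tn.
  have [x [y [xy Lx Ly xyP]]] := two_cofaces Lmfd Lt tn.
  rewrite (bd_two xy) => [|z zx zy]; last first.
    apply: (bichain_eq0 Fm) => -[_ /xyP[] /eqP]; first by rewrite (negbTE zx).
    by rewrite (negbTE zy).
  have sub z : {subset s <= z :: t} by move=> w /st wt; rewrite inE wt orbT.
  rewrite /from_cochain !asboolT // (muN t x y) //.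
  have E (a b : R) : a * - b + a * b = 0 by rewrite mulrN addNr.
  exact: E.
rewrite scaler0 addr0 coboundary_cobd asboolT // -cobd_mulr.
apply: cobd_ext => u x v sE; rewrite /from_cochain.
have [->|uv0] := eqVneq (u ++ v) [::]; last first.
  by rewrite asboolT //; apply: (incident_face (x := x)) uv0 _; rewrite -sE.
have -> : f [::] = 0; last by rewrite mul0r if_same.
by apply/eqP/negPn/negP => /fS[/ordered_simplex_neq0].
Qed.

Lemma sign_sqr k (x : R^o) : (-1) ^+ k *: ((-1) ^+ k *: x) = x.
Proof. by rewrite scalerA -exprD addnn -mul2n exprM sqrrN !expr1n scale1r. Qed.

(** Each row is a top cycle of the star of [s], hence a multiple of [mu]; the
    multiple is recovered from the value at one [n]-simplex [T], which must depend
    only on the set of vertices of [s] for the result to be alternating. *)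
Lemma bichain_from_cochain m F : bichain L m F ->
  (forall s t, (size t <= n)%N -> total_diff L F s t = 0) ->
  (forall s t, (size t < n.+1)%N -> F s t = 0) ->
  exists2 f, chain L (n%:Z - m) f & F = from_cochain f.
Proof.
move=> Fm DF F0; have [Fl Fr [B FB] FS] := Fm; have [muA muS mu1 muN] := mu_orient.
have [T TP] : exists T : {fset V} -> seq V, forall s, ordered_simplex L s ->
    incident L s (T [fset x in s]%fset) /\ size (T [fset x in s]%fset) = n.+1.
  suff /choice[T TP] : forall C : {fset V}, exists t, forall s, ordered_simplex L s ->
      [fset x in s]%fset = C -> incident L s t /\ size t = n.+1.
    by exists T => s Ls; exact: TP.
  move=> C.
  have [[s [Ls sC]]|nC] := EM (exists s, ordered_simplex L s /\ [fset x in s]%fset = C).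
    have [t [Lt tn]] := purity Lmfd Ls.
    exists (t ++ s) => s' Ls' s'C; split=> //; split=> // x.
    have : x \in [fset x in s']%fset = (x \in [fset x in s]%fset) by rewrite s'C sC.
    by rewrite !inE mem_cat => <- ->; rewrite orbT.
  by exists [::] => s Ls sC; case: nC; exists s.
exists (fun s => F s (T [fset x in s]%fset) * mu (T [fset x in s]%fset)).
  apply/chainP; split.
  - split=> [s x y u|s ns]; last by rewrite (Fl _).2 // mul0r.
    rewrite (fset_seq_perm (swap_perm _ _ _ _)) (Fl _).1; exact: mulNr.
  - exists B => s x xs xB.
    have -> : F s (T [fset x in s]%fset) = 0; last exact: mul0r.
    apply/eqP/negPn/negP => Fs; have [[_ _ /(_ _ xs) xT] _] := FS _ _ Fs.
    by case/negP: Fs; rewrite (FB _ _ _ xT xB).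
  move=> s Fs; have [|[Ls _ _] <-] := FS s (T [fset x in s]%fset).
    by apply: contraNneq Fs => ->; rewrite mul0r.
  by split=> //; rewrite (TP s Ls).2; lia.
apply/funext => s; apply/funext => t; rewrite /from_cochain.
case: asboolP => [[Ls Lt st]|]; last exact: (bichain_eq0 Fm).
have Fs : star_chain L s n.+1 (F s).
  split=> // u Fu; have [[_ Lu su] _] := FS _ _ Fu; split=> //.
  apply/eqP; rewrite eqn_leq (simplex_size_le Lmfd Lu) leqNgt.
  by apply: contra Fu => un; rewrite F0.
have [|a aE] := star_top Lmfd Ls mu_orient Fs.
  move=> u Lu su; have [un|un] := leqP (size u) n; last first.
    by apply: bd0 => x; apply/eqP/negPn/negP => /Fs.2[_ _ /= []]; lia.
  have := DF s u un; rewrite /total_diff asboolT // cobd0 => [|*]; last exact: F0.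
  rewrite add0r => /(congr1 ( *:%R ((-1) ^+ size s))).
  by rewrite sign_sqr scaler0.
have [[_ LT sT] Tn] := TP s Ls; rewrite (aE _ sT) -[a * _ * _]mulrA (mu1 _ LT Tn) mulr1.
exact: aE.
Qed.

(** For each [s], the layer [k] is a cycle of the star of [s], by the vanishing of
    the layers below, and [star_exact] gives a preimage. Preimages are chosen for
    the default enumeration of each set of vertices, and carried to the other
    orderings by [sgn]. *)
Lemma lowest_layer m k F : bichain L m F -> (k <= n)%N ->
  (forall s t, (size t <= n)%N -> total_diff L F s t = 0) ->
  (forall s t, (size t < k)%N -> F s t = 0) ->
  exists2 H, bichain L (m + 1) H &
    forall s t, (size t < k.+1)%N -> total_diff L H s t = F s t.
Proof.
move=> Fm kn DF Fk; have [Fl Fr [B FB] FS] := Fm.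
pose Fk' s t : R^o := if size t == k then F s t else 0.
have Fk'A s : altern (Fk' s).
  split=> [t x y u|t nt]; rewrite /Fk'; last by rewrite (Fr s).2 // if_same.
  by rewrite !size_cat (Fr s).1; case: ifP; rewrite ?oppr0.
have /choice[h hP] : forall C : {fset V}, exists hC : seq V -> R^o,
    ordered_simplex L (enum_fset C) -> star_chain L (enum_fset C) k.+1 hC /\
    forall t, {subset enum_fset C <= t} -> bd hC t = Fk' (enum_fset C) t.
  move=> C; set e := enum_fset C.
  have [Le|nL] := EM (ordered_simplex L e); last by exists 0.
  have Fe : star_chain L e k (Fk' e).
    split=> // t; rewrite /Fk'.
    case: (size t =P k) => [tk /FS[[_ Lt et] _]|]; last by rewrite eqxx.
    by split.
  have [|h hS hE] := star_exact Lmfd Le Fe kn; last by exists h.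
  move=> t Lt et; have [tk|tk] := eqVneq (size t).+1 k; last first.
    by apply: bd0 => x; rewrite /Fk' /= (negbTE tk).
  have := DF e t; rewrite -tk in kn; move=> /(_ (ltnW kn)).
  rewrite /total_diff asboolT // cobd0 => [|*]; last by apply: Fk; rewrite -tk.
  rewrite add0r => /(congr1 ( *:%R ((-1) ^+ size e))); rewrite sign_sqr scaler0 => E.
  by rewrite -[RHS]E; apply: bd_ext => x; rewrite /Fk' /= tk eqxx.
(* A chosen preimage of 0 could be nonzero: [P] restores the degree and the
   finite support. *)
pose P s := [&& `[< ordered_simplex L s >], all (mem B) s & k%:Z - (size s)%:Z == m].
have P_perm s s' : perm_eq s s' -> P s = P s'.
  move=> ss'; rewrite /P (eq_all_r (perm_mem ss')) (perm_size ss').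
  congr andb; apply: asbool_equiv_eq; split; apply: ordered_simplex_perm => //.
  by rewrite perm_sym.
pose c (C : {fset V}) : R := sgn R (enum_fset C).
pose H s t : R^o := if P s then
  (-1) ^+ size s *: ((sgn R s * c [fset x in s]%fset) *: h [fset x in s]%fset t) else 0.
have enumP s : P s -> ordered_simplex L (enum_fset [fset x in s]%fset).
  case/andP=> /asboolP Ls _; apply: (ordered_simplex_perm _ Ls).
  exact: perm_enum_fset Ls.1.
have HS s t : H s t != 0 -> P s /\ h [fset x in s]%fset t != 0.
  rewrite /H; case: ifP => [Ps E|]; last by rewrite eqxx.
  by split=> //; apply: contraNneq E => ->; rewrite !scaler0.
have Hinc s t : H s t != 0 -> incident L s t /\ size t = k.+1.
  move=> /HS[Ps ht]; have [hS _] := hP _ (enumP s Ps).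
  have [Lt et tk] := hS.2 _ ht; have /andP[/asboolP Ls _] := Ps.
  split=> //; split=> // x xs; apply: et.
  by rewrite -(perm_mem (perm_enum_fset Ls.1)).
have [C HC] := near_finite B Lmfd.1.
have HB s : supp_in C (H s).
  move=> t x xt xC; apply/eqP/negPn/negP => Hst; have [[Ls Lt st] _] := Hinc _ _ Hst.
  have [/and3P[_ /allP sB _] _] := HS _ _ Hst.
  have [y ys] := ordered_simplex_mem Ls.
  by case/negP: xC; apply: (HC t y) => //; [exact: st | exact: sB].
have Hr s : altern (H s).
  rewrite /H; have [Ps|_] := boolP (P s); last by split=> // *; exact/esym/(@oppr0 R^o).
  have [[hA _] _] := hP _ (enumP s Ps).
  split=> [t x y u|t nt]; last by rewrite hA.2 // !scaler0.
  by rewrite hA.1 !scalerN.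
have Hm : bichain L (m + 1) H.
  split=> //; last 2 first.
  - by exists C.
  - move=> s t Hst; have [I tk] := Hinc _ _ Hst; split=> //.
    have [/and3P[_ _ /eqP <-] _] := HS _ _ Hst.
    by rewrite tk; lia.
  move=> t; split=> [s x y u|s ns]; rewrite /H.
    rewrite (P_perm _ _ (swap_perm _ _ _ _)) (fset_seq_perm (swap_perm _ _ _ _)).
    rewrite (altern_sgn V R).1 !size_cat /= mulNr scaleNr scalerN.
    by case: ifP; rewrite ?oppr0.
  by rewrite (altern_sgn V R).2 // mul0r scale0r scaler0 if_same.
exists H => // s t tk; rewrite /total_diff; case: asboolP => [I|]; last first.
  by move/(bichain_eq0 Fm).
have [Ls Lt st] := I.
rewrite cobd0 => [|u x v _]; last first.
  by apply/eqP/negPn/negP => /Hinc[_ tE]; rewrite tE ltnn in tk.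
rewrite add0r; have [tk'|tk'] := eqVneq (size t) k; last first.
  rewrite Fk; last by rewrite ltn_neqAle tk' -ltnS.
  rewrite bd0 ?scaler0 // => x; apply/eqP/negPn/negP => /Hinc[_ /= [tE]].
  by rewrite tE eqxx in tk'.
have [Ps|nP] := boolP (P s); last first.
  rewrite bd0 => [|x]; last by rewrite /H (negbTE nP).
  rewrite scaler0; apply/esym/eqP/negPn/negP => Fst; case/negP: nP.
  rewrite /P asboolT //=; have [_ tE] := FS _ _ Fst; rewrite -tk' tE eqxx andbT.
  apply/allP => x /st xt; apply: contraNT Fst => xB.
  by rewrite (FB _ _ _ xt).
set e := enum_fset [fset x in s]%fset.
have [hS hE] := hP _ (enumP s Ps); have es := perm_enum_fset Ls.1.
have -> : bd (H s) t = (-1) ^+ size s *: ((sgn R s * c [fset x in s]%fset) *: Fk' e t).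
  rewrite -hE => [|x]; last by rewrite -(perm_mem es); exact: st.
  have [D hD] := star_supp R Lmfd.1 (enumP s Ps).
  rewrite (bdE _ (hD _ _ hS)) (@bdE _ _ D) => [|u x xu xD].
    by rewrite !scaler_sumr; apply: eq_bigr => x _; rewrite /H Ps.
  by rewrite /H Ps (hD _ _ hS _ _ xu xD) !scaler0.
rewrite sign_sqr /Fk' tk' eqxx (altern_enum (Fl t) Ls.1).
exact: esym (mulrA _ _ _).
Qed.

(** The layers with [t] of dimension less than [n] are removed one at a time, from
    the bottom. *)
Lemma reduce_to_cochain m j F : bichain L m F ->
  (forall s t, (size t <= n)%N -> total_diff L F s t = 0) ->
  (forall s t, (size t < n.+1 - j)%N -> F s t = 0) ->
  exists2 f, chain L (n%:Z - m) f &
    exists2 H, bichain L (m + 1) H & F = from_cochain f + total_diff L H.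
Proof.
elim: j F => [|j IH] F Fm DF Fj.
  rewrite subn0 in Fj.
  have [f fc ->] := bichain_from_cochain Fm DF Fj; exists f => //.
  exists 0; first exact: bichain0.
  by rewrite total_diff0 addr0.
have [nj|jn] := ltnP n j.
  by apply: IH => // s t; rewrite (eqP (_ : (n.+1 - j == 0)%N)) // subn_eq0.
have [|H Hm HE] := lowest_layer Fm (k := (n - j)%N) (leq_subr _ _) DF.
  by move=> s t; rewrite -subSS; exact: Fj.
have DHm := total_bichain Hm; rewrite addrK in DHm.
have GE : F - total_diff L H = (-1) *: total_diff L H + F by rewrite scaleN1r addrC.
have [|||f fc [K Km KE]] := IH (F - total_diff L H).
- by rewrite GE; exact: bichain_lin.
- move=> s t st; rewrite GE (total_diff_lin _ DHm Fm) (total_diff_diff Hm) scaler0 add0r.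
  exact: DF.
- by move=> s t; rewrite subSn // => st; rewrite !fctE HE // subrr.
exists f => //; exists (1 *: K + H); first exact: bichain_lin.
by rewrite (total_diff_lin _ Km Hm) scale1r addrA -KE subrK.
Qed.

End FromCochains.

(** * Isomorphisms of subquotients and twisted modules *)

Lemma linear_bijection (R : pzRingType) (M N : lmodType R) (F : M -> N) :
  linear F -> injective F -> (forall y, exists x, F x = y) ->
  exists f : {linear M -> N}, bijective f /\ f =1 F.
Proof.
move=> Fl Fi /choice[g gK].
pose fl := GRing.isLinear.Build R M N *:%R F Fl.
pose f : {linear M -> N} := HB.pack F fl.
exists f; split=> //; exists g => // x; apply: Fi; exact: gK.
Qed.

Section Correspondence.
Variables (R : pzRingType) (W W' : lmodType R).
Variables (Z B : submodule W) (Z' B' : submodule W') (rel : W -> W' -> Prop).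
Hypothesis rel_lin : forall a x y x' y', rel x x' -> rel y y' ->
  rel (a *: x + y) (a *: x' + y').
Hypothesis rel_total : forall x, Z x -> exists2 x', Z' x' & rel x x'.
Hypothesis rel_onto : forall x', Z' x' -> exists2 x, Z x & rel x x'.
Hypothesis rel_sub : forall x x', Z x -> Z' x' -> rel x x' -> B x <-> B' x'.

(** A zigzag of inclusions gives a relation between cycles, not a map. Linearity
    makes it single-valued and injective modulo boundaries as soon as it matches
    boundaries with boundaries. *)
Lemma subquotient_iso :
  exists f : {linear subquotient Z B -> subquotient Z' B'}, bijective f /\
    forall (z : sub_of Z) (z' : sub_of Z'), rel (val z) (val z') ->
      f (sq_class B z) = sq_class B' z'.
Proof.
have Zv (S : submodule W) (z : sub_of S) : S (val z) by apply/smpredP; exact: valP.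
have Zv' (S : submodule W') (z : sub_of S) : S (val z) by apply/smpredP; exact: valP.
have relB x y x' y' : rel x x' -> rel y y' -> rel (x - y) (x' - y').
  by move=> rx ry; rewrite [x - y]addrC [x' - y']addrC -!scaleN1r; exact: rel_lin.
have relP (z y : sub_of Z) (z' y' : sub_of Z') : rel (val z) (val z') ->
    rel (val y) (val y') -> sq_class B z = sq_class B y <-> sq_class B' z' = sq_class B' y'.
  move=> rz ry; rewrite !sq_classP.
  by apply: rel_sub; [exact: smemB | exact: smemB | exact: relB].
have /choice[F FP] : forall q : subquotient Z B, exists z' : sub_of Z',
    rel (val (sq_repr q)) (val z').
  move=> q; have [x' Zx' rx'] := rel_total (Zv _ (sq_repr q)).
  have Zx : x' \in smpred Z' by apply/smpredP.
  by exists (SubOf Zx).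
pose F' q := sq_class B' (F q).
have Fspec (z : sub_of Z) (z' : sub_of Z') : rel (val z) (val z') ->
    F' (sq_class B z) = sq_class B' z'.
  by move=> rz; apply/(relP _ _ _ _ (FP _) rz); exact: sq_reprK.
have [|||f [fB fE]] := @linear_bijection R (subquotient Z B) (subquotient Z' B') F'.
- move=> a p q; rewrite -[p]sq_reprK -[q]sq_reprK -sq_class_linear.
  rewrite (Fspec _ (F p) (FP p)) (Fspec _ (F q) (FP q)) -sq_class_linear.
  by apply: Fspec; rewrite !linearP; apply: rel_lin; exact: FP.
- move=> p q /(relP _ _ _ _ (FP p) (FP q)).
  by rewrite !sq_reprK.
- move=> q; have [x Zx rx] := rel_onto (Zv' _ (sq_repr q)).
  have Zx' : x \in smpred Z by apply/smpredP.
  exists (sq_class B (SubOf Zx')); rewrite -[RHS]sq_reprK; exact: Fspec.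
by exists f; split=> // z z' rz; rewrite fE; exact: Fspec.
Qed.

End Correspondence.

Section Twist.
Variables (R : comNzRingType) (G : groupType) (M N : rmodule R G).
Variables (t : right_action G R^o) (chi : G -> R).
Hypothesis tE : forall x g, t x g = chi g * x.
Hypothesis chi1 : forall g, chi g * chi g = 1.
Variable f : {linear M -> N}.
Hypothesis f_bij : bijective f.
Hypothesis f_act : forall x g, f (ract x g) = chi g *: ract (f x) g.

Local Notation T := (RModule t).
Local Notation W := (M * R^o -> R^o)%type.
Local Notation span := (@tensor_span R M R^o).

Definition tensor_eval (P : W) : N := \sum_(p \in [set: M * R^o]) P p *: (p.2 *: f p.1).

Lemma tensor_evalE (C : {fset M * R^o}) (P : W) :
  (forall p, p \notin C -> P p = 0) ->
  tensor_eval P = \sum_(p <- C) P p *: (p.2 *: f p.1).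
Proof. by move=> PC; apply: fsbigTE => p /PC ->; rewrite scale0r. Qed.

Lemma fin_supported_fset (P : W) : fin_supported P ->
  exists C : {fset M * R^o}, forall p, p \notin C -> P p = 0.
Proof.
move=> fP; exists (fset_set [set p | P p != 0]) => p; rewrite in_fset_set //.
by rewrite notin_setE /= => /negP/negPn/eqP.
Qed.

Lemma fset_fin_supported (C : {fset M * R^o}) (P : W) :
  (forall p, p \notin C -> P p = 0) -> fin_supported P.
Proof.
move=> PC; apply: (@sub_finite_set _ _ [set` C]); last exact: finite_fset.
by move=> p /=; apply: contraNT => /PC ->.
Qed.

Lemma tensor_eval_lin a (P Q : W) : fin_supported P -> fin_supported Q ->
  tensor_eval (a *: P + Q) = a *: tensor_eval P + tensor_eval Q.
Proof.
move=> /fin_supported_fset[C PC] /fin_supported_fset[D QD].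
have PCD p : p \notin (C `|` D)%fset -> P p = 0.
  by rewrite inE negb_or => /andP[/PC].
have QCD p : p \notin (C `|` D)%fset -> Q p = 0.
  by rewrite inE negb_or => /andP[_ /QD].
rewrite (tensor_evalE PCD) (tensor_evalE QCD) (@tensor_evalE (C `|` D)%fset).
  rewrite scaler_sumr -big_split; apply: eq_bigr => p _; rewrite !fctE scalerDl.
  by congr (_ + _); exact: esym (scalerA _ _ _).
by move=> p pCD; rewrite !fctE PCD // QCD // scaler0 addr0.
Qed.

Lemma pure_delta_out (m : M) (r : R^o) p :
  p \notin [fset (m, r)]%fset -> pure_delta m r p = 0.
Proof. by rewrite inE /pure_delta => /negbTE ->. Qed.

Lemma pure_delta_fin (m : M) (r : R^o) : fin_supported (pure_delta m r).
Proof. exact: fset_fin_supported (@pure_delta_out m r). Qed.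

Lemma tensor_eval_delta (m : M) (r : R^o) : tensor_eval (pure_delta m r) = r *: f m.
Proof.
rewrite (tensor_evalE (@pure_delta_out m r)) big_seq_fset1 /pure_delta eqxx.
exact: scale1r.
Qed.

Lemma tensor_eval_span (P : W) : span P -> tensor_eval P = 0.
Proof.
have S0 : fin_supported (0 : W) /\ tensor_eval 0 = 0.
  split; first exact: fin_supported0.
  by apply: fsbig1 => p _; rewrite scale0r.
have SP a (P' Q : W) : fin_supported P' /\ tensor_eval P' = 0 ->
    fin_supported Q /\ tensor_eval Q = 0 ->
    fin_supported (a *: P' + Q) /\ tensor_eval (a *: P' + Q) = 0.
  move=> [fP eP] [fQ eQ]; split; first exact: fin_supportedP.
  by rewrite tensor_eval_lin // eP eQ scaler0 addr0.
move=> /(_ (Submodule (smem := fun P => fin_supported P /\ tensor_eval P = 0) S0 SP)).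
case=> // Q QE.
have evB (x y : W) : fin_supported x -> fin_supported y -> tensor_eval x = tensor_eval y ->
    fin_supported (x - y) /\ tensor_eval (x - y) = 0.
  move=> fx fy exy; rewrite addrC -scaleN1r; split; first exact: fin_supportedP.
  by rewrite tensor_eval_lin // exy scaleN1r addNr.
case: QE => [[a [m [m' [r ->]]]]|[a [m [r [r' ->]]]]]; apply: evB;
  try exact: pure_delta_fin; try (by apply: fin_supportedP; exact: pure_delta_fin).
  rewrite tensor_eval_lin ?tensor_eval_delta; try exact: pure_delta_fin.
  by rewrite linearP scalerDr !scalerA mulrC.
rewrite tensor_eval_lin ?tensor_eval_delta; try exact: pure_delta_fin.
by rewrite scalerDl -scalerA.
Qed.

(** Modulo the bilinearity relations, [(m, r)] is [(r m, 1)] and the pairs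
    [(m, 1)] add up; so every element is the pure tensor with 1 of the preimage by
    [f] of its evaluation. *)
Lemma tensor_eval_eq0 (P : W) : fin_supported P -> tensor_eval P = 0 -> span P.
Proof.
move=> fP eP; have [C PC] := fin_supported_fset fP.
pose b (m : M) (r : R^o) := to_quot span (pure_delta m r).
have b1 a m m' r : b (a *: m + m') r = a *: b m r + b m' r.
  rewrite /b -to_quot_linear; apply/to_quotP => S; apply.
  by left; exists a, m, m', r.
have b2 a m r r' : b m (a *: r + r') = a *: b m r + b m r'.
  rewrite /b -to_quot_linear; apply/to_quotP => S; apply.
  by right; exists a, m, r, r'.
have b01 r : b 0 r = 0.
  have /eqP := b1 1 0 0 r; rewrite scaler0 scale1r addr0 eq_sym addrC.
  by rewrite -subr_eq0 addrK => /eqP.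
have b02 m : b m 0 = 0.
  have /eqP := b2 1 m 0 0; rewrite scaler0 scale1r addr0 eq_sym addrC.
  by rewrite -subr_eq0 addrK => /eqP.
have bs (m : M) (r : R^o) : b m r = b (r *: m) 1.
  have := b2 r m 1 0; have := b1 r m 0 1.
  by rewrite !addr0 b01 b02 !addr0 => -> <-; rewrite scale1o.
have [g fK gK] := f_bij.
have bsum (r : seq (M * R^o)) : \sum_(p <- r) P p *: b p.1 p.2 =
    b (g (\sum_(p <- r) P p *: (p.2 *: f p.1))) 1.
  elim: r => [|p r IH].
    have -> : g (\sum_(p <- [::]) P p *: (p.2 *: f p.1)) = 0.
      by apply: (can_inj fK); rewrite gK big_nil linear0.
    by rewrite b01 big_nil.
  rewrite !big_cons IH bs -b1; congr (b _ _); apply: (can_inj fK).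
  by rewrite linearP !gK linearZ.
have := bsum C; rewrite -(tensor_evalE PC) eP.
have -> : g 0 = 0 by apply: (can_inj fK); rewrite gK linear0.
rewrite b01; under eq_bigr do rewrite /b -linearZ /=.
rewrite -linear_sum /= -(linear0 (to_quot span)) => /to_quotP; rewrite subr0.
have -> // : \sum_(p <- C) P p *: pure_delta p.1 p.2 = P.
apply/funext => p; rewrite fct_sumE; have [pC|pC] := boolP (p \in C).
  rewrite (big_fsetD1 p) //= big1_fset => [|q].
    by rewrite addr0 !fctE /pure_delta -surjective_pairing eqxx scale1o.
  rewrite !inE => /andP[qp _] _.
  by rewrite !fctE /pure_delta -surjective_pairing eq_sym (negbTE qp) scaler0.
rewrite PC // big1_fset // => q qC _.
rewrite !fctE /pure_delta -surjective_pairing; case: (p =P q) pC => [->|_ _].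
  by rewrite qC.
by rewrite scaler0.
Qed.

Lemma ract0 g : ract (0 : N) g = 0.
Proof.
have := act_linear (ract (r := N)) g (-1) 0 0.
by rewrite scaler0 addr0 scaleN1r addNr.
Qed.

Lemma ract_sum (P : rmodule R G) (I : Type) (r : seq I) (F : I -> P) g :
  ract (\sum_(i <- r) F i) g = \sum_(i <- r) ract (F i) g.
Proof.
pose fl := GRing.isLinear.Build R P P *:%R _ (act_linear (ract (r := P)) g).
pose h : {linear P -> P} := HB.pack (fun x : P => ract x g) fl.
exact: (linear_sum h).
Qed.

Lemma tensor_eval_act (P : W) g : fin_supported P ->
  tensor_eval (@diag_act R G M T P g) = ract (tensor_eval P) g.
Proof.
move=> /fin_supported_fset[C PC]; rewrite [in RHS](tensor_evalE PC) ract_sum.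
rewrite /tensor_eval (reindex_fsbigT (fun p : M * R^o => (ract p.1 g, t p.2 g))); last first.
  exists (fun p => (ract p.1 g^-1%g, t p.2 g^-1%g)) => -[m r] /=.
    by rewrite ractK; congr pair; exact: (ractK (P := T)).
  by rewrite ractVK; congr pair; exact: (ractVK (P := T)).
have E p : @diag_act R G M T P g (ract p.1 g, t p.2 g) *: (t p.2 g *: f (ract p.1 g)) =
    ract (P p *: (p.2 *: f p.1)) g.
  have -> : @diag_act R G M T P g (ract p.1 g, t p.2 g) = P p.
    rewrite /diag_act /= ractK; case: p => m r /=; congr (P (_, _)).
    exact: (ractK (P := T)).
  have rZ a (x : N) : ract (a *: x) g = a *: ract x g.
    by have := act_linear (ract (r := N)) g a x 0; rewrite ract0 !addr0.
  rewrite !rZ f_act tE; congr (_ *: _); rewrite scalerA; congr (_ *: _).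
  by rewrite mulrAC chi1 mul1r.
under eq_fsbigr do rewrite E.
by apply: fsbigTE => p /PC ->; rewrite scale0r ract0.
Qed.

(** On pure tensors the isomorphism sends [(m, r)] to [r f(m)]. The sign by which
    [g] acts on [r] and the one by which [f] fails to commute with [g] cancel. *)
Lemma tensor_twist : rmodule_iso (tensor M T) N.
Proof.
have fin (z : sub_of (tensor_free M T)) : fin_supported (val z).
  have : tensor_free M T (val z) by apply/smpredP; exact: valP.
  by [].
have evE (z y : sub_of (tensor_free M T)) :
    sq_class (tensor_span M T) z = sq_class (tensor_span M T) y <->
    tensor_eval (val z) = tensor_eval (val y).
  have E : tensor_eval (val z - val y) = tensor_eval (val z) - tensor_eval (val y).
    by rewrite [val z - _]addrC -scaleN1r tensor_eval_lin // scaleN1r addrC.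
  rewrite sq_classP; split=> [/tensor_eval_span/eqP|/eqP].
    by rewrite E subr_eq0 => /eqP.
  rewrite -subr_eq0 -E => /eqP; apply: tensor_eval_eq0.
  by rewrite addrC -scaleN1r; exact: fin_supportedP.
pose F (q : tensor M T) : N := tensor_eval (val (sq_repr q)).
have FE z : F (sq_class (tensor_span M T) z) = tensor_eval (val z).
  by apply/evE; exact: sq_reprK.
have [|||h [h_bij hE]] := @linear_bijection R (tensor M T) N F.
- move=> a p q; rewrite -[p]sq_reprK -[q]sq_reprK -sq_class_linear !FE.
  by rewrite linearP tensor_eval_lin //; exact: fin.
- by move=> p q /evE; rewrite !sq_reprK.
- move=> y; have [g fK gK] := f_bij.
  have d : pure_delta (g y) (1 : R^o) \in smpred (tensor_free M T).
    by apply/smpredP; exact: pure_delta_fin.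
  exists (sq_class _ (SubOf d)); rewrite FE /= tensor_eval_delta gK; exact: scale1r.
exists h; split=> // q g; rewrite !hE -[q]sq_reprK; move: (sq_repr q) => z.
rewrite /= sq_actE; last exact: tensor_span_act.
apply: (etrans (FE (sub_act (tensor_free_act (M := M) (N := T)) z g))).
apply: (etrans (tensor_eval_act g (fin z))).
exact: (congr1 (fun x => ract x g) (esym (FE z))).
Qed.

End Twist.

(** * Duality *)

Section Duality.
Variables (R : comNzRingType) (n : nat) (V : choiceType) (L : complex V).
Hypothesis Lmfd : homology_manifold R n L.
Variable mu : seq V -> R^o.
Hypothesis mu_orient : coeff_orientation n L mu.
Implicit Types (f c : seq V -> R^o) (F G H : seq V -> seq V -> R^o) (i m : int).

(** Equality in the homology of the total complex. *)
Definition dual (i : int) f c : Prop := exists2 H, bichain L (n%:Z - i + 1) H &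
  from_cochain L mu f = from_chain c + total_diff L H.

Lemma dual_lin i a f c f' c' : dual i f c -> dual i f' c' ->
  dual i (a *: f + f') (a *: c + c').
Proof.
move=> [H Hm E] [H' Hm' E']; exists (a *: H + H'); first exact: bichain_lin.
rewrite from_cochain_lin from_chain_lin (total_diff_lin _ Hm Hm') E E' scalerDr.
by rewrite addrACA.
Qed.

Lemma from_cochain_low f s t : (size t <= n)%N -> from_cochain L mu f s t = 0.
Proof.
move=> tn; rewrite /from_cochain; case: asboolP => // _.
have -> : mu t = 0; last exact: mulr0.
have [_ muS _ _] := mu_orient.
by apply/eqP/negPn/negP => /muS[_ tE]; rewrite tE ltnn in tn.
Qed.

Lemma from_chain_high c (s t : seq V) : (1 < size s)%N -> from_chain c s t = 0.
Proof. by case: s => [|x [|y s]]. Qed.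

Lemma from_chain0 : from_chain (0 : seq V -> R^o) = 0.
Proof. by apply/funext => -[|x [|y s]]; apply/funext => t //=; rewrite if_same. Qed.

Lemma from_cochain0 : from_cochain L mu 0 = 0.
Proof.
apply/funext => s; apply/funext => t; rewrite /from_cochain.
by case: asboolP => // _; exact: mul0r.
Qed.

Lemma manifold_reduce_to_chain m F : bichain L m F ->
  (forall s t, (1 < size s)%N -> total_diff L F s t = 0) ->
  exists2 c, chain L m c &
    exists2 H, bichain L (m + 1) H & F = from_chain c + total_diff L H.
Proof.
move=> Fm DF; apply: (@reduce_to_chain _ _ L _ n) => // s t sn.
apply/eqP/negPn/negP => Fst; have [_ _ _ FS] := Fm.
have [[[us _] Lt st] _] := FS _ _ Fst.
have := leq_trans (uniq_leq_size us st) (simplex_size_le Lmfd Lt).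
by rewrite leqNgt sn.
Qed.

Lemma dual_total i f : compact_cocycles R L i f ->
  exists2 c, cycles R L (n%:Z - i) c & dual i f c.
Proof.
move=> [fc bf].
have Df : total_diff L (from_cochain L mu f) = 0.
  by rewrite (total_from_cochain Lmfd mu_orient fc) bf from_cochain0.
have [|c cc [H Hm E]] := manifold_reduce_to_chain (from_cochain_bichain Lmfd mu_orient fc).
  by move=> s t _; rewrite Df.
exists c; last by exists H.
split=> //; have := congr1 (total_diff L) E; rewrite Df.
rewrite (total_diffD (from_chain_bichain cc) (total_bichain Hm)).
rewrite (total_diff_diff Hm) addr0 (total_from_chain cc) => /esym/eqP.
by rewrite oppr_eq0 => /eqP; exact: from_chain_inj.
Qed.

Lemma coboundary_simplex f s : coboundary L f s != 0 -> ordered_simplex L s.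
Proof. by rewrite coboundary_cobd; case: asboolP => //; rewrite eqxx. Qed.

Lemma dual_onto i c : cycles R L (n%:Z - i) c ->
  exists2 f, compact_cocycles R L i f & dual i f c.
Proof.
move=> [cc bc]; have Fm := from_chain_bichain cc.
have Dc : total_diff L (from_chain c) = 0.
  by rewrite (total_from_chain cc) bc from_chain0 oppr0.
have [||f fc [H Hm E]] := @reduce_to_cochain _ n _ L Lmfd mu mu_orient _ n.+1 _ Fm.
- by move=> s t _; rewrite Dc.
- by move=> s t; rewrite subnn.
rewrite opprB addrC subrK in fc.
exists f; last first.
  exists (0 - H); first by apply: bichainB => //; exact: bichain0.
  rewrite (total_diffB (bichain0 R L 0) Hm) E.
  by rewrite total_diff0 sub0r addrK.
split=> //; have := congr1 (total_diff L) E; rewrite Dc.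
rewrite (total_diffD (from_cochain_bichain Lmfd mu_orient fc) (total_bichain Hm)).
rewrite (total_diff_diff Hm) addr0 (total_from_cochain Lmfd mu_orient fc) => /esym.
by apply: (from_cochain_inj Lmfd mu_orient) => // s; exact: coboundary_simplex.
Qed.

(** If [f] is the coboundary of [e], then [c] is the total boundary of the
    difference of the image of [e] and the witness of duality. The reduction to a
    chain applies to this difference and shows that [c] bounds; conversely the
    reduction to a cochain is used in the same way. *)
Lemma dual_sub i f c : compact_cocycles R L i f -> cycles R L (n%:Z - i) c ->
  dual i f c -> compact_coboundaries R L i f <-> boundaries R L (n%:Z - i) c.
Proof.
move=> [fc _] [cc _] [H Hm E]; split=> [[e ec fE]|[b bcc cE]].
  have em := from_cochain_bichain Lmfd mu_orient ec.
  have deg : n%:Z - (i - 1) = n%:Z - i + 1 by rewrite opprB addrCA addrC.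
  rewrite deg in em.
  have DG : total_diff L (from_cochain L mu e - H) = from_chain c.
    rewrite (total_diffB em Hm) (total_from_cochain Lmfd mu_orient ec) -fE E.
    by rewrite addrK.
  have [|b bcc [K Km GE]] := manifold_reduce_to_chain (bichainB em Hm).
    by move=> s t ss; rewrite DG from_chain_high.
  move: DG; rewrite GE (total_diffD (from_chain_bichain bcc) (total_bichain Km)).
  rewrite (total_diff_diff Km) addr0 (total_from_chain bcc) => bE.
  have -> : c = -1 *: boundary b; last by apply: smemZ; exists b.
  apply/eqP; rewrite -subr_eq0; apply/eqP/from_chain_inj.
    rewrite !fctE scaler0 subr0; have /chainP[_ _ cS] := cc.
    by apply/eqP/negPn/negP => /cS[/ordered_simplex_neq0].
  have := from_chain_lin (-1) (-1 *: boundary b) c; rewrite scaleN1r addrC => ->.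
  rewrite -bE; have := from_chain_lin (-1) (boundary b) 0.
  rewrite addr0 from_chain0 addr0 => ->.
  by rewrite !scaleN1r opprK subrr.
have bm := from_chain_bichain bcc.
have DG : total_diff L (H - from_chain b) = from_cochain L mu f.
  by rewrite (total_diffB Hm bm) (total_from_chain bcc) opprK E cE addrC.
have [||e ec [K Km GE]] :=
    @reduce_to_cochain _ n _ L Lmfd mu mu_orient _ n.+1 _ (bichainB Hm bm).
- by move=> s t tn; rewrite DG from_cochain_low.
- by move=> s t; rewrite subnn.
have deg : n%:Z - (n%:Z - i + 1) = i - 1 by rewrite opprD opprB addrA addrCA subrr addr0.
rewrite deg in ec; exists e => //.
move: DG; rewrite GE (total_diffD (from_cochain_bichain Lmfd mu_orient ec) (total_bichain Km)).
rewrite (total_diff_diff Km) addr0 (total_from_cochain Lmfd mu_orient ec) => bE.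
apply/eqP; rewrite -subr_eq0; apply/eqP/(from_cochain_inj Lmfd mu_orient) => // [s|].
  move=> E0; apply: contrapT => nL; case/negP: E0; apply/eqP; rewrite !fctE.
  have -> : coboundary L e s = 0.
    by apply/eqP; apply: contra_notT nL; exact: coboundary_simplex.
  rewrite subr0; have /chainP[_ _ fS] := fc.
  by apply/eqP/negPn/negP => /fS[].
have := from_cochain_lin L mu (-1) (coboundary L e) f; rewrite scaleN1r addrC => ->.
by rewrite -bE scaleN1r addNr.
Qed.

Lemma duality i : exists f : {linear compact_cohomology R L i -> homology R L (n%:Z - i)},
  bijective f /\ forall z z', dual i (val z) (val z') ->
    f (sq_class (compact_coboundaries R L i) z) = sq_class (boundaries R L (n%:Z - i)) z'.
Proof.
apply: (@subquotient_iso R _ _ _ _ _ _ (dual i)).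
- by move=> b x y x' y'; exact: dual_lin.
- exact: dual_total.
- exact: dual_onto.
- exact: dual_sub.
Qed.

End Duality.

Section Equivariance.
Variables (R : comNzRingType) (n : nat) (V : choiceType) (L : complex V).
Variables (G : groupType) (a : simplicial_action G L).
Implicit Types (f c mu : seq V -> R^o) (F H : seq V -> seq V -> R^o) (g : G).

Definition pull2 F g s t : R^o := F (map (a g) s) (map (a g) t).

Lemma map_sactK g : cancel (map (a g)) (map (a g^-1%g)).
Proof. exact: mapK (sactK a g). Qed.

Lemma incident_map g s t : incident L (map (a g) s) (map (a g) t) <-> incident L s t.
Proof.
have st : {subset map (a g) s <= map (a g) t} <-> {subset s <= t}.
  split=> [st x xs|st _ /mapP[x xs ->]]; last by apply: map_f; exact: st.
  have /mapP[y yt /(can_inj (sactK a g)) ->] := st _ (map_f (a g) xs).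
  exact: yt.
split=> -[Ls Lt sub]; split.
- exact: (ordered_simplex_map a g s).1.
- exact: (ordered_simplex_map a g t).1.
- exact: st.1.
- exact: (ordered_simplex_map a g s).2.
- exact: (ordered_simplex_map a g t).2.
- exact: st.2.
Qed.

Lemma altern_pull (A : zmodType) (f : seq V -> A) g :
  altern f -> altern (fun s => f (map (a g) s)).
Proof.
move=> [fN f0]; split=> [s x y t|s ns]; first by rewrite !map_cat /= fN.
by apply: f0; rewrite map_inj_uniq //; exact: can_inj (sactK a g).
Qed.

Lemma pull2_bichain m F g : bichain L m F -> bichain L m (pull2 F g).
Proof.
move=> [Fl Fr [B FB] FS]; split.
- by move=> t; apply: (altern_pull g (Fl _)).
- by move=> s; apply: (altern_pull g (Fr _)).
- exists [fset a g^-1%g x | x in B]%fset => s t x xt xB.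
  apply: (FB _ _ (a g x)); first exact: map_f.
  apply: contra xB => xB; apply/imfsetP; exists (a g x) => //.
  by rewrite sactK.
by move=> s t /FS; rewrite !size_map => -[/incident_map].
Qed.

Lemma pull2_total F g : pull2 (total_diff L F) g = total_diff L (pull2 F g).
Proof.
apply/funext => s; apply/funext => t; rewrite /pull2 /total_diff.
rewrite (asbool_equiv_eq (incident_map g s t)); case: asboolP => // _.
rewrite size_map; congr (_ + _ *: _).
  exact: cobd_map.
apply: (reindex_fsbigT (a g) (fun x => F (map (a g) s) (x :: map (a g) t))).
by exists (a g^-1%g); [exact: sactK | exact: sactVK].
Qed.

Lemma pull2_from_chain c g : pull2 (from_chain c) g = from_chain (pull a c g).
Proof.
apply/funext => -[|x [|y s]]; apply/funext => t //=.
rewrite /pull2 /= /pull (mem_map (can_inj (sactK a g))) //.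
Qed.

Lemma pull2_from_cochain mu chi f g : pull a mu g = chi *: mu ->
  pull2 (from_cochain L mu f) g = chi *: from_cochain L mu (pull a f g).
Proof.
move=> muE; apply/funext => s; apply/funext => t; rewrite !fctE.
rewrite /pull2 /from_cochain (asbool_equiv_eq (incident_map g s t)).
case: asboolP => _; last by rewrite scaler0.
have -> : mu (map (a g) t) = chi * mu t by exact: (congr1 (fun f => f t) muE).
exact: mulrCA.
Qed.

(** The total complex is acted on by the group; the scalar [chi] moves from [mu] to
    the chain because its square is 1. *)
Lemma dual_pull mu chi i f c g : pull a mu g = chi *: mu -> chi * chi = 1 ->
  dual n L mu i f c -> dual n L mu i (pull a f g) (chi *: pull a c g).
Proof.
move=> muE chi1 [H Hm E].
have H'm := pull2_bichain g Hm.
exists (chi *: pull2 H g + 0); first by apply: bichain_lin => //; exact: bichain0.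
rewrite (total_diff_lin _ H'm (bichain0 R L 0)).
have := congr1 (fun F => chi *: pull2 F g) E.
rewrite (pull2_from_cochain _ muE) scalerA chi1 scale1r => ->.
rewrite total_diff0 addr0 -pull2_total -[chi *: pull a c g]addr0.
rewrite from_chain_lin from_chain0 addr0.
by rewrite -scalerDr -pull2_from_chain.
Qed.

End Equivariance.

(** * Orientations and the orientation character *)

Lemma coeff_orientation_char2 (R : comNzRingType) n (V : choiceType) (L : complex V) :
  2%N \in [pchar R] -> coeff_orientation n L
    (fun s => if `[< ordered_simplex L s /\ size s = n.+1 >] then 1 else 0 : R^o).
Proof.
move=> R2; have N1 (x : R^o) : - x = x by exact: (oppr_pchar2 R2 x).
split.
- split=> [s x y t|s ns]; last by rewrite asboolF // => -[[us]]; rewrite us in ns.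
  rewrite N1; congr (if _ then _ else _); apply: asbool_equiv_eq; rewrite !size_cat.
  by split=> -[Ls sn]; split=> //; apply: ordered_simplex_perm Ls; exact: swap_perm.
- by move=> s; case: asboolP => //; rewrite eqxx.
- by move=> s Ls sn; rewrite asboolT // mulr1.
by move=> t x y Lt tn xy Lx Ly; rewrite N1 !asboolT //= tn.
Qed.

Section Orientation.
Variables (R : comNzRingType) (n : nat) (V : choiceType) (L : complex V).
Hypothesis Lmfd : homology_manifold R n L.
Implicit Types (o : seq V -> int) (s t : seq V).

Lemma orientation_eq0 o s : orientation n L o ->
  ~ (ordered_simplex L s /\ size s = n.+1) -> o s = 0.
Proof. by move=> [[o0 _] _ _] ns; apply: o0; rewrite size_dimP. Qed.

Lemma coeff_orientation_int o : orientation n L o ->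
  coeff_orientation n L (fun s => (o s)%:~R : R^o).
Proof.
move=> oo; have [[o0 oN] o1 oc] := oo; split.
- split=> [s x y t|s ns]; first by rewrite oN mulrNz.
  by rewrite (orientation_eq0 oo) // => -[[us]]; rewrite us in ns.
- move=> s os; apply: contrapT => ns; case/negP: os.
  by rewrite (orientation_eq0 oo ns).
- by move=> s Ls sn; rewrite -intrM; case: (o1 s Ls sn) => ->.
by move=> t x y Lt tn xy Lx Ly; rewrite (oc t x y) // mulrNz.
Qed.

Hypothesis R2 : 2%N \notin [pchar R].

Lemma sign_inj (x y : int) : x = 1 \/ x = -1 -> y = 1 \/ y = -1 ->
  x%:~R = y%:~R :> R -> x = y.
Proof.
have N1 : 1 <> -1 :> R.
  move/eqP; rewrite -addr_eq0 => /eqP E; move/negP: R2; apply.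
  by rewrite inE /= -E; apply/eqP.
by move=> [] -> [] -> //; rewrite mulrNz => E; case: N1; rewrite // E.
Qed.

(** Both orientations generate the top cycles of the star of [v] with coefficients
    in [R], so that they differ there by a constant. *)
Lemma orientation_star_sign o o' v : orientation n L o -> orientation n L o' ->
  ordered_simplex L [:: v] -> exists e : int, (e = 1 \/ e = -1) /\
    forall t, v \in t -> o' t = e * o t.
Proof.
move=> oo oo' Lv; have mu_or := coeff_orientation_int oo.
have mu_or' := coeff_orientation_int oo'.
have [|a aE] := star_top Lmfd Lv mu_or (to_star_chain [:: v] mu_or').
  by move=> t Lt st; exact: (to_star_cycle Lmfd mu_or' Lt st).
have {}aE t : v \in t -> (o' t)%:~R = a * (o t)%:~R :> R.
  move=> vt; have st : {subset [:: v] <= t} by move=> x; rewrite inE => /eqP ->.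
  by rewrite -(aE t st) /to_star /= vt.
have [t0 [Lt0 t0n]] := purity Lmfd Lv.
have vt0 : v \in t0 ++ [:: v] by rewrite mem_cat inE eqxx orbT.
have [_ o1 _] := oo; have [_ o1' _] := oo'.
have sgM (x y : int) : x = 1 \/ x = -1 -> y = 1 \/ y = -1 -> x * y = 1 \/ x * y = -1.
  by move=> [] -> [] ->; [left|right|right|left].
exists (o' (t0 ++ [:: v]) * o (t0 ++ [:: v])); split; first by apply: sgM; auto.
move=> t vt; have [[Lt tn]|nt] := EM (ordered_simplex L t /\ size t = n.+1); last first.
  by rewrite !(orientation_eq0 _ nt) // mulr0.
have pm1 := o1 _ Lt0 t0n; have pm2 := o1' _ Lt0 t0n; have pm3 := o1 _ Lt tn.
apply: sign_inj; [exact: o1' | exact: (sgM _ _ (sgM _ _ pm2 pm1) pm3) |].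
rewrite !intrM !aE //.
by case: pm1 => ->; rewrite ?mulr1z ?mulrN1z ?mulrN1 ?mulr1 ?mulrN1 ?opprK.
Qed.

(** Two orientations compare by a sign on the star of each vertex. Stars of
    adjacent vertices share a top simplex, so the sign is constant. As the
    comparison takes place in [R], the elements [1] and [-1] must differ there. *)
Lemma orientation_sign o o' : connected_complex L ->
  orientation n L o -> orientation n L o' ->
  exists e : int, (e = 1 \/ e = -1) /\ forall t, o' t = e * o t.
Proof.
move=> [[v0 Lv0] Lc] oo oo'.
have vx v : L [fset v]%fset <-> ordered_simplex L [:: v].
  by rewrite /ordered_simplex fset_seq_single; split=> [|[]].
have [e [e1 eE]] := orientation_star_sign oo oo' ((vx v0).1 Lv0).
have step u w : `[< L [fset u; w]%fset >] -> (forall t, u \in t -> o' t = e * o t) ->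
    forall t, w \in t -> o' t = e * o t.
  move=> /asboolP Luw uE t wt.
  have Lw : ordered_simplex L [:: w].
    apply/vx; apply: simplex_face Luw _ _.
      by apply/fsubsetP => x; rewrite !inE => ->; rewrite orbT.
    by apply/eqP => /fsetP/(_ w); rewrite !inE eqxx.
  have [e' [e1' eE']] := orientation_star_sign oo oo' Lw.
  have Luw' : ordered_simplex L (enum_fset [fset u; w]%fset).
    split; first exact: fset_uniq.
    rewrite (_ : [fset x in _]%fset = [fset u; w]%fset) //.
    by apply/fsetP => x; rewrite !inE.
  have [t0 [Lt0 t0n]] := purity Lmfd Luw'.
  have ut0 : u \in t0 ++ enum_fset [fset u; w]%fset by rewrite mem_cat !inE eqxx orbT.
  have wt0 : w \in t0 ++ enum_fset [fset u; w]%fset by rewrite mem_cat !inE eqxx !orbT.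
  rewrite eE' //; congr (_ * _); have := uE _ ut0; rewrite eE' //.
  by have [_ o1 _] := oo; case: (o1 _ Lt0 t0n) => ->; lia.
have all_v w : L [fset w]%fset -> forall t, w \in t -> o' t = e * o t.
  move=> Lw; have [p [vp <-]] := Lc _ _ Lv0 Lw.
  elim: p (v0) eE vp {Lw} => [//|x p IH] u uE /= /andP[ux xp].
  by apply: IH => //; exact: step uE.
exists e; split=> // t.
have [[Lt tn]|nt] := EM (ordered_simplex L t /\ size t = n.+1); last first.
  by rewrite !(orientation_eq0 _ nt) // mulr0.
case: t Lt {tn} => [/ordered_simplex_neq0 //|x t] Lt.
apply: (all_v x); rewrite ?inE ?eqxx //; apply/vx.
by apply: (ordered_simplex_sub Lt) => // y; rewrite !inE => ->.
Qed.

End Orientation.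

Section Character.
Variables (R : comNzRingType) (n : nat) (V : choiceType) (L : complex V).
Variables (G : groupType) (a : simplicial_action G L).
Hypothesis Lmfd : homology_manifold R n L.
Hypothesis Lconn : connected_complex L.

Lemma top_simplex_exists : exists s, ordered_simplex L s /\ size s = n.+1.
Proof.
have [[v Lv] _] := Lconn; have Lv' : ordered_simplex L [:: v].
  by split=> //; rewrite fset_seq_single.
by have [t Lt] := purity Lmfd Lv'; exists (t ++ [:: v]).
Qed.

Lemma push_orientation g o : orientation n L o -> orientation n L (push a g o).
Proof.
move=> [oA o1 oc]; split.
- exact: (@pull_alternating _ _ _ a int n%:Z o g^-1%g oA).
- move=> s Ls sn; apply: o1; last by rewrite size_map.
  exact/ordered_simplex_map.
move=> t x y Lt tn xy Lx Ly; apply: (oc (map (a g^-1%g) t)).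
- exact/ordered_simplex_map.
- by rewrite size_map.
- by apply: contra xy => /eqP/(can_inj (sactK a g^-1%g)) ->.
- exact: (ordered_simplex_map a g^-1%g (x :: t)).2.
exact: (ordered_simplex_map a g^-1%g (y :: t)).2.
Qed.

Lemma orientation_character : orientable n L -> 2%N \notin [pchar R] ->
  exists chi : G -> int, [/\ forall g, chi g = 1 \/ chi g = -1,
    forall g o, orientation n L o -> forall s, push a g o s = chi g * o s,
    chi 1%g = 1 & forall g h, chi (g * h)%g = chi g * chi h].
Proof.
move=> [o oo] R2.
have /choice[chi chiP] g := orientation_sign Lmfd R2 Lconn oo (push_orientation g oo).
have [s [Ls sn]] := top_simplex_exists.
have os : o s = 1 \/ o s = -1 by have [_ o1 _] := oo; exact: o1.
exists chi; split=> [g|g o' oo' t||g h].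
- by have [] := chiP g.
- have [e [_ eE]] := orientation_sign Lmfd R2 Lconn oo oo'.
  rewrite [LHS]/push !eE; have := (chiP g).2 t; rewrite /push => ->.
  exact: mulrCA.
- have := (chiP 1%g).2 s; rewrite /push invg1 -[map _ _]/(map (a 1%g) s).
  have -> : map (a 1%g) s = s by rewrite -[RHS]map_id; apply: eq_map => v; exact: sact1.
  by case: os => ->; lia.
have : push a (g * h)%g o s = chi g * (chi h * o s).
  have := (chiP g).2 s; have := (chiP h).2 (map (a g^-1%g) s).
  rewrite /push invgM => hE gE; rewrite mulrCA -gE -hE -map_comp.
  by congr o; apply: eq_map => v; exact: sactM.
by rewrite (chiP _).2; case: os => ->; lia.
Qed.

Lemma orientation_action_exists : orientable n L \/ 2%N \in [pchar R] ->
  exists t : right_action G R^o, orientation_action n a t.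
Proof.
have [R2 _|R2] := boolP (2%N \in [pchar R]).
  have N1 (x : R^o) : - x = x by exact: (oppr_pchar2 R2 x).
  have lin (g : G) : linear (fun x : R^o => x) by [].
  have h1 (x : R^o) : x = x by [].
  exists (@RightAction R G R^o (fun x _ => x) lin h1 (fun x _ _ => h1 x)).
  by split=> // _ g x; split=> //=; rewrite N1.
case=> // Lor; have [chi [chi1 chiE chi_1 chiM]] := orientation_character Lor R2.
have lin g : linear (fun x : R^o => (chi g)%:~R * x : R^o).
  by move=> b x y; rewrite mulrDr; congr (_ + _); exact: mulrCA.
have a1 (x : R^o) : (chi 1%g)%:~R * x = x by rewrite chi_1 mul1r.
have aM (x : R^o) g h : (chi (g * h)%g)%:~R * x = (chi h)%:~R * ((chi g)%:~R * x).
  by rewrite chiM intrM mulrA; congr (_ * _); exact: mulrC.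
exists (RightAction lin a1 aM); split=> [[o oo] g x|]; last by move=> E; rewrite E in R2.
have [s [Ls sn]] := top_simplex_exists.
have os : o s = 1 \/ o s = -1 by have [_ o1 _] := oo; exact: o1.
have pE := chiE g o oo s.
split=> /(_ o oo) E; rewrite E in pE; rewrite /=; case: (chi1 g) pE => -> pE.
- by move: pE; rewrite -[(- o) s]/(- o s); case: os => ->.
- by rewrite mulrN1z mulN1r.
- by rewrite mul1r.
by move: pE; case: os => ->.
Qed.

(** Both cases of the theorem give an orientation with coefficients in [R] that
    the group multiplies by the same signs by which it acts on [R]. *)
Lemma orientation_action_char (t : right_action G R^o) :
  orientable n L \/ 2%N \in [pchar R] -> orientation_action n a t ->
  exists mu (chi : G -> R), [/\ coeff_orientation n L mu,
    forall g, chi g * chi g = 1, forall x g, t x g = chi g * x &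
    forall g, pull a mu g = chi g *: mu].
Proof.
have [R2 _|R2] := boolP (2%N \in [pchar R]).
  move=> [_ /(_ R2) t1].
  exists (fun s => if `[< ordered_simplex L s /\ size s = n.+1 >] then 1 else 0).
  exists (fun=> 1); split=> [|g|x g|g]; rewrite ?mulr1 //.
  - exact: coeff_orientation_char2.
  - by rewrite t1 mul1r.
  rewrite scale1r; apply/funext => s; rewrite /pull; congr (if _ then _ else _).
  by apply: asbool_equiv_eq; rewrite size_map ordered_simplex_map.
case=> // Lor [/(_ Lor) tP _].
have [chi [chi1 chiE _ _]] := orientation_character Lor R2.
have [o oo] := Lor; exists (fun s => (o s)%:~R), (fun g => (chi g)%:~R); split.
- exact: coeff_orientation_int.
- by move=> g; rewrite -intrM; case: (chi1 g) => ->.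
- move=> x g; have [tN t1] := tP g x; case: (chi1 g) => cE; rewrite cE.
    rewrite t1 ?mul1r // => o' oo'; apply/funext => s.
    by rewrite chiE // cE mul1r.
  rewrite mulrNz mulN1r tN // => o' oo'; apply/funext => s.
  by rewrite chiE // cE mulN1r.
move=> g; apply/funext => s; rewrite /pull.
have := chiE g o oo (map (a g) s); rewrite /push (map_sactK a g) => oE.
rewrite -[RHS]/((chi g)%:~R * (o s)%:~R) oE -intrM mulrA.
by case: (chi1 g) => ->; rewrite ?mulrNN !mul1r.
Qed.

End Character.

Theorem theorem5 (R : comNzRingType) (n : nat) (V : choiceType)
    (L : complex V) (G : groupType) (a : simplicial_action G L)
    (Lconn : connected_complex L) (Lmfd : homology_manifold R n L)
    (afree : free_action a)
    (orient : orientable n L \/ 2%N \in [pchar R]) :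
  (exists t : right_action G R^o, orientation_action n a t) /\
  forall t : right_action G R^o, orientation_action n a t ->
  forall i : int,
    rmodule_iso
      (tensor (compact_cohomology_rmodule a R i) (RModule t))
      (homology_rmodule a R (n%:Z - i)).
Proof.
split; first exact: orientation_action_exists.
move=> t tP i.
have [mu [chi [mu_or chi1 tE muE]]] := orientation_action_char Lmfd Lconn orient tP.
have [f [f_bij fE]] := duality Lmfd mu_or i.
apply: (@tensor_twist R G (compact_cohomology_rmodule a R i)
          (homology_rmodule a R (n%:Z - i)) t chi tE chi1 f f_bij).
move=> q g; rewrite -[q]sq_reprK; move: (sq_repr q) => z.
have zZ : compact_cocycles R L i (val z) by apply/smpredP; exact: valP.
have [c cZ zc] := dual_total Lmfd mu_or zZ.
have cZ' : c \in smpred (cycles R L (n%:Z - i)) by apply/smpredP.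
have zcg := dual_pull (muE g) (chi1 g) zc.
rewrite (fE z (SubOf cZ')) // /= !sq_actE; last first.
- exact: compact_coboundaries_act.
- exact: boundaries_act.
have zg := fE (sub_act (@compact_cocycles_act _ _ _ a R i) z g)
              (chi g *: sub_act (@cycles_act _ _ _ a R (n%:Z - i)) (SubOf cZ') g).
rewrite zg; last by rewrite linearZ /= /chain_act push_pull.
exact: linearZ.
Qed.
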